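(* Let $(P,\mathcal F_1,\mathcal F_2)$ be a bifoliated plane, and let $\mathrm{Aut}^+(P,\mathcal F_1,\mathcal F_2)$ be the group of homeomorphisms of $P$ that preserve each of the foliations $\mathcal F_1$ and $\mathcal F_2$ as well as their orientations. Then $\mathrm{Aut}^+(P,\mathcal F_1,\mathcal F_2)$ is left-orderable.
   Context: A bifoliated plane $(P,\mathcal F_1,\mathcal F_2)$ consists of a topological plane $P$ (a space homeomorphic to $\mathbb R^2$) with two $C^0$ (non-singular) foliations by lines $\mathcal F_1,\mathcal F_2$ such that each leaf is properly embedded in $P$, and the foliations are topologically transverse: around each point there is a coordinate chart mapping leaves of $\mathcal F_1$ and $\mathcal F_2$ to horizontal and vertical straight lines in $\mathbb R^2$, respectively. Both foliations are assumed to be oriented. A group is left-orderable if it admits a linear (total) order invariant under left multiplication. *)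

(* Defs.v *)
From HB Require Import structures.
From mathcomp Require Import all_boot all_order all_algebra.
From mathcomp Require Import boolp classical_sets functions reals topology.
From mathcomp Require Import normedtype.

Set Implicit Arguments.
Unset Strict Implicit.
Unset Printing Implicit Defensive.

Import Order.TTheory GRing.Theory Num.Theory.
Import numFieldNormedType.Exports.

Local Open Scope classical_set_scope.
Local Open Scope ring_scope.

Definition left_orderable (G : groupType) : Prop :=
  exists le : rel G,
    [/\ reflexive le, antisymmetric le, transitive le, total le
      & forall g x y : G, le x y -> le (g * x)%g (g * y)%g].

Definition homeomorphic (X Y : topologicalType) : Prop :=
  exists (f : X -> Y) (g : Y -> X),
    [/\ continuous f, continuous g, cancel f g & cancel g f].

Section Foliations.
Variables (R : realType) (P : topologicalType).
Implicit Types (F : set (set P)) (U : set P) (phi : P -> R * R).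

Definition proper_embedding (gamma : R -> P) : Prop :=
  [/\ continuous gamma, injective gamma,
      forall V, open V ->
        exists2 W, open W & gamma @` V = W `&` range gamma
    & forall K, compact K -> compact (gamma @^-1` K)].

Definition properly_embedded_line (L : set P) : Prop :=
  exists2 gamma : R -> P, proper_embedding gamma & range gamma = L.

(* [phi] matters only on [U], which it maps homeomorphically onto the plane. *)
Definition chart U phi : Prop :=
  [/\ open U, {within U, continuous phi}, set_bij U [set: R * R] phi
    & forall V, open V -> V `<=` U -> open (phi @` V)].

(* A leaf may cross [U] several times; what is asked is that each connected
   component of its trace on [U] is a full level line of the coordinate [c]:
   a horizontal line for [c := snd], a vertical one for [c := fst]. *)
Definition straightens F U phi (c : R * R -> R) : Prop :=
  forall L x, F L -> (L `&` U) x ->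
    connected_component (L `&` U) x =
      U `&` [set y | c (phi y) = c (phi x)].

(* [F] is the set of leaves. *)
Definition line_foliation F : Prop :=
  [/\ partition F id [set: P],
      forall p, exists U phi, [/\ chart U phi, U p & straightens F U phi snd]
    & forall L, F L -> properly_embedded_line L].

Definition transverse F1 F2 : Prop :=
  forall p, exists U phi,
    [/\ chart U phi, U p, straightens F1 U phi snd & straightens F2 U phi fst].

(* An orientation is encoded by the strict order of the points along each
   leaf: [prec x y] means that [x] and [y] lie on a common leaf and that [y]
   comes after [x].  The last clause says that the directions of the leaves
   vary continuously. *)
Definition orientation F (prec : P -> P -> Prop) : Prop :=
  [/\ forall x y, prec x y -> exists2 L, F L & L x /\ L y,
      forall L, F L -> exists gamma : R -> P,
        [/\ proper_embedding gamma, range gamma = L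
          & forall s t, prec (gamma s) (gamma t) <-> s < t]
    & forall p, exists U phi,
        [/\ chart U phi, U p, straightens F U phi snd
          & forall x y, U x -> U y -> (phi x).2 = (phi y).2 ->
              (phi x).1 < (phi y).1 -> prec x y]].

End Foliations.

Record bifoliated_plane (R : realType) := BifoliatedPlane {
  plane :> topologicalType;
  fol1 : set (set plane);
  fol2 : set (set plane);
  prec1 : plane -> plane -> Prop;
  prec2 : plane -> plane -> Prop;
  plane_homeo : homeomorphic plane (R * R)%type;
  fol1P : line_foliation R fol1;
  fol2P : line_foliation R fol2;
  fol_transverse : transverse R fol1 fol2;
  prec1P : orientation R fol1 prec1;
  prec2P : orientation R fol2 prec2
}.

Section Automorphisms.
Variables (R : realType) (B : bifoliated_plane R).

Definition preserves_foliation (F : set (set B)) (f : B -> B) : Prop :=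
  [set f @` L | L in F] = F.

Definition preserves_orientation (prec : B -> B -> Prop) (f : B -> B) : Prop :=
  forall x y, prec (f x) (f y) <-> prec x y.

Definition is_aut (f : B -> B) : Prop :=
  [/\ preserves_foliation (@fol1 R B) f, preserves_foliation (@fol2 R B) f,
      preserves_orientation (@prec1 R B) f
    & preserves_orientation (@prec2 R B) f].

Record aut_plus := AutPlus {
  aut_fun :> B -> B;
  aut_inv : B -> B;
  aut_funK : cancel aut_fun aut_inv;
  aut_invK : cancel aut_inv aut_fun;
  aut_fun_continuous : continuous aut_fun;
  aut_inv_continuous : continuous aut_inv;
  aut_funP : is_aut aut_fun
}.

Lemma aut_plus_eq (f g : aut_plus) : aut_fun f =1 aut_fun g -> f = g.
Proof.
case: f g => [f f' fK f'K fc f'c fP] [g g' gK g'K gc g'c gP] /= fg.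
have {}fg : f = g by apply: funext.
subst g; have fg' : f' = g'.
  by apply: funext => x; rewrite -{1}(g'K x) fK.
subst g'; f_equal; exact: Prop_irrelevance.
Qed.

Lemma id_aut : is_aut id.
Proof. by split=> //; rewrite /preserves_foliation;
  under eq_imagel do rewrite image_id; rewrite image_id. Qed.

Lemma comp_aut (f g : B -> B) : is_aut f -> is_aut g -> is_aut (f \o g).
Proof.
have compF F : preserves_foliation F f -> preserves_foliation F g ->
    preserves_foliation F (f \o g).
  move=> fF gF; rewrite /preserves_foliation -{2}fF -{2}gF image_comp.
  by apply: eq_imagel => L _; rewrite /= image_comp.
by move=> [f1 f2 f3 f4] [g1 g2 g3 g4]; split; [exact: compF|exact: compF|..]
  => x y; rewrite /= (f3, f4) (g3, g4).
Qed.

Lemma inv_aut (f g : B -> B) : cancel f g -> cancel g f -> is_aut f -> is_aut g.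
Proof.
move=> fK gK.
have invF F : preserves_foliation F f -> preserves_foliation F g.
  move=> fF; rewrite /preserves_foliation -{1}fF image_comp.
  rewrite -[RHS]image_id; apply: eq_imagel => L _ /=.
  rewrite image_comp -[RHS]image_id.
  by apply: eq_imagel => x _ /=; rewrite fK.
by move=> [f1 f2 f3 f4]; split; [exact: invF|exact: invF|..]
  => x y; rewrite -(f3, f4) !gK.
Qed.

Lemma comp_continuous (f g : B -> B) :
  continuous g -> continuous f -> continuous (f \o g).
Proof. by move=> gc fc x; apply: continuous_comp; [exact: gc|exact: fc]. Qed.

Definition aut_one : aut_plus :=
  @AutPlus id id (fun=> erefl) (fun=> erefl)
    (fun=> cvg_id) (fun=> cvg_id) id_aut.

Definition aut_mul (f g : aut_plus) : aut_plus :=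
  @AutPlus (f \o g) (aut_inv g \o aut_inv f)
    (can_comp (aut_funK f) (aut_funK g)) (can_comp (aut_invK g) (aut_invK f))
    (comp_continuous (@aut_fun_continuous g) (@aut_fun_continuous f))
    (comp_continuous (@aut_inv_continuous f) (@aut_inv_continuous g))
    (comp_aut (aut_funP f) (aut_funP g)).

Definition aut_inverse (f : aut_plus) : aut_plus :=
  @AutPlus (aut_inv f) f (aut_invK f) (aut_funK f)
    (@aut_inv_continuous f) (@aut_fun_continuous f)
    (inv_aut (aut_funK f) (aut_invK f) (aut_funP f)).

Lemma aut_mulA : associative aut_mul.
Proof. by move=> f g h; apply: aut_plus_eq. Qed.
Lemma aut_mul1 : left_id aut_one aut_mul.
Proof. by move=> f; apply: aut_plus_eq. Qed.
Lemma aut_mulr1 : right_id aut_one aut_mul.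
Proof. by move=> f; apply: aut_plus_eq. Qed.
Lemma aut_mulV : left_inverse aut_one aut_inverse aut_mul.
Proof. by move=> f; apply: aut_plus_eq => x /=; rewrite aut_funK. Qed.
Lemma aut_mulVr : right_inverse aut_one aut_inverse aut_mul.
Proof. by move=> f; apply: aut_plus_eq => x /=; rewrite aut_invK. Qed.

HB.instance Definition _ := gen_eqMixin aut_plus.
HB.instance Definition _ := gen_choiceMixin aut_plus.
HB.instance Definition _ :=
  isGroup.Build aut_plus aut_mulA aut_mul1 aut_mulr1 aut_mulV aut_mulVr.

End Automorphisms.

(* Main.v *)
Require Import Defs.
From mathcomp Require Import all_boot all_order all_algebra reals.
From mathcomp Require Import boolp classical_sets functions topology normedtype.
From mathcomp Require Import wochoice lra zify.

(* A leaf of the first foliation has a positive end on the circle at infinity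
   of the plane.  The leaves themselves trivialise the turning of directions
   over the contractible plane, so these ends lift coherently to the universal
   cover of that circle, where they are linearly ordered by the group.

   No circle is constructed.  For a leaf [l], [height l p] plays the role of
   the floor of (lifted end of [l]) - (lifted end of the leaf through [p]): it
   is constant along the leaves of the first foliation and drops by one when
   [p], moving up along a leaf of the second foliation, makes the positive ray
   of its leaf sweep over the positive end of [l].  The heights exist because
   the plane has no first cohomology.  Leaves are compared by the sign of
   their heights, points on a common leaf by the orientation.  The result is
   an invariant total order on the plane, and a group that acts faithfully on
   a totally ordered set is left-orderable. *)

Set Implicit Arguments.
Unset Strict Implicit.
Unset Printing Implicit Defensive.

Import Order.TTheory GRing.Theory Num.Theory.
Import numFieldNormedType.Exports.

Local Open Scope classical_set_scope.
Local Open Scope ring_scope.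

(** * Connectedness and interval induction *)

(** Two leaves need not be crossed by a common leaf of the other foliation, so they cannot be
    compared directly; they are compared by counting along a path, and the vanishing of cohomology
    makes the count independent of the path. If [e] were a real lift of the ends, floors would obey
    two rules: floor(t) + floor(-t) = -1 for non-integer t, and floor(s + t) is floor(s) + floor(t)
    or one more. [height_antisym] and [height_bounds] are these rules, and they yield totality and
    transitivity; as no [e] is available, both must come from the counts. The obstacle is that
    heights with different first arguments are separate potentials, each controlled only in its
    second argument. [height_transport] relates them: it computes the effect of moving the first
    argument. The vanishing of cohomology also has an earlier use: applied to the jump across a
    leaf, it separates the plane into two sides, in place of the Jordan curve theorem. Sides and
    heights are characterised uniquely, not chosen, and this is what makes the order invariant. *)

Section Connectedness.
Variable T : topologicalType.
Implicit Types A B E : set T.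

(** A property that is locally constant on [A] is both open and closed relative to [A].
    Connectedness is used in this form throughout, with [E] a property to be propagated. *)
Lemma connected_near A E : connected A ->
    (forall p, A p -> \forall q \near p, A q -> (E q <-> E p)) ->
  forall p q, A p -> A q -> E p -> E q.
Proof.
move=> cA AE p q Ap Aq Ep.
suff AEA : A `&` E = A by move: Aq; rewrite -AEA => -[].
apply: cA; first by exists p.
- exists [set r | A r -> E r]°; first exact: open_interior.
  apply/seteqP; split=> x [Ax].
    move=> Ex; split=> //; apply: filterS (AE x Ax) => r + Ar.
    by move=> /(_ Ar) ->.
  by move=> /interior_subset /(_ Ax).
- exists (~` [set r | A r -> ~ E r]°).
    by rewrite closedC; exact: open_interior.
  apply/seteqP; split=> x [Ax].
    by move=> Ex; split=> // /interior_subset /(_ Ax).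
  move=> nEx; split=> //; apply: contrapT => Ex; apply: nEx.
  by apply: filterS (AE x Ax) => r + Ar => /(_ Ar) ->.
Qed.

Lemma near_connected A :
    (forall E, (forall p, A p -> \forall q \near p, A q -> (E q <-> E p)) ->
      forall p q, A p -> A q -> E p -> E q) ->
  connected A.
Proof.
move=> cA B [p Bp] [C oC BC] [D cD BD].
have [Ap Cp] : A p /\ C p by move: Bp; rewrite BC.
apply/seteqP; split=> [x|q Aq]; first by rewrite BC => -[].
apply: (cA B) Bp => // x Ax; have [Bx|nBx] := pselect (B x).
  have Cx : C x by move: Bx; rewrite BC => -[].
  by near=> r => Ar; split=> // _; rewrite BC; split=> //; near: r; exact: open_nbhs_nbhs.
have nDx : (~` D) x by move=> Dx; apply: nBx; rewrite BD.
have oD : open (~` D) by rewrite openC.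
near=> r => Ar; split=> // Br; exfalso.
suff : (~` D) r by apply; move: Br; rewrite BD => -[].
by near: r; exact: open_nbhs_nbhs.
Unshelve. all: by end_near. Qed.

Lemma connected_between A B :
  connected A -> A `<=` B -> B `<=` closure A -> connected B.
Proof.
move=> cA AB BA; apply: near_connected => E EB.
have EA p : B p -> exists2 a, A a & (E a <-> E p).
  move=> Bp; have [a [Aa]] := BA p Bp _ (EB p Bp).
  by move=> /(_ (AB a Aa)) Eap; exists a.
move=> p q /EA[a Aa ap] /EA[b Ab bq] /ap Ea; apply/bq.
apply: (connected_near cA) Ea => // r Ar.
by apply: filterS (EB r (AB r Ar)) => s + /AB.
Qed.

End Connectedness.

Section IntervalInduction.
Variable R : realType.

Lemma near_itv (t e : R) : 0 < e -> \forall s \near t, t - e < s < t + e.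
Proof.
move=> e0; apply: filterS (nbhsx_ballx t e e0) => s.
by rewrite -ball_normE /= ltr_distlC.
Qed.

(** The [s] with [Q a s] form an open and closed subset of the line. Empty intervals are allowed, so
    the endpoints need no ordering hypothesis. It serves to glue potentials and to extend
    monotonicity or increment formulas along a leaf. *)
Lemma itv_ind (Q : R -> R -> Prop) :
  (forall a b a' b', a <= a' -> b' <= b -> Q a b -> Q a' b') ->
  (forall a b c d, a <= c -> c < b -> b <= d -> Q a b -> Q c d -> Q a d) ->
  (forall t, exists2 e, 0 < e & Q (t - e) (t + e)) ->
  forall a b, Q a b.
Proof.
move=> Qmono Qglue Qloc a b.
have [ea ea0 Qa] := Qloc a.
apply: (@connected_near R setT (Q a)) (I : setT a) _ _ => //.
- by apply/connected_intervalP => x y _ _ z.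
- move=> t _; have [e e0 Qt] := Qloc t.
  have step s s' : t - e < s -> s' < t + e -> Q a s -> Q a s'.
    move=> es s'e Qs; have [ea'|ae] := leP (t - e) a.
      by apply: Qmono Qt => //; exact: ltW.
    have [s's|ss'] := leP s' s; first exact: Qmono Qs.
    apply: (Qglue a s (t - e) s') => //; [exact: ltW|exact: ltW|].
    by apply: Qmono Qt => //; exact: ltW.
  near=> s => _.
  have [s1 s2] : t - e < s /\ s < t + e.
    by apply/andP; near: s; exact: near_itv.
  by split; apply: step => //; rewrite ?ltrBlDr ?ltrDl.
- by apply: Qmono Qa; rewrite ?gerBl ?lerDl; exact: ltW.
Unshelve. all: by end_near. Qed.

End IntervalInduction.

(** * The plane has no first cohomology *)

Section Potential.
Variables (T : topologicalType) (U : T -> set T) (f : T -> T -> int).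
Hypothesis U_self : forall p, U p p.
Hypothesis f_compat : forall p q w, U p w -> U q w ->
  \forall v \near w, f p v - f q v = f p w - f q w.

(* The functions [f p], given up to locally constant terms, glue to [g] over [A]. *)
Definition potential (A : set T) (g : T -> int) := forall p w, A w -> U p w ->
  \forall v \near w, g v - f p v = g w - f p w.

Lemma potentialS A B g : A `<=` B -> potential B g -> potential A g.
Proof. by move=> AB gB p w /AB; exact: gB. Qed.

Lemma potential_local p : potential (U p) (f p).
Proof. by move=> q w; exact: f_compat. Qed.

Lemma potential_shift A g c : potential A g -> potential A (fun v => g v - c).
Proof.
move=> gA p w Aw Uw; apply: filterS (gA p w Aw Uw) => v.
by rewrite addrAC => ->; rewrite addrAC.
Qed.

Lemma potential_uniq A g g' : connected A -> potential A g -> potential A g' ->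
  forall v w, A v -> A w -> g v - g' v = g w - g' w.
Proof.
move=> cA gA g'A v w Av Aw.
apply: (@connected_near _ A [set v | g v - g' v = g w - g' w] cA) Aw Av _ => //.
move=> p Ap; near=> q => _ /=.
suff -> : g q - g' q = g p - g' p by [].
have E1 : g q - f p q = g p - f p p by near: q; exact: gA.
have E2 : g' q - f p q = g' p - f p p by near: q; exact: g'A.
lia.
Unshelve. all: by end_near. Qed.

(** On a connected overlap the two potentials differ by a constant, which is absorbed into one of
    them; on an empty overlap any constant does. *)
Lemma potential_glue A B g g' : open A -> open B -> connected (A `&` B) ->
  potential A g -> potential B g' -> exists h, potential (A `|` B) h.
Proof.
move=> oA oB cAB gA g'B.
have [c cE] : exists c, forall w, A w -> B w -> g w = g' w + c.
  have [[w [Aw Bw]]|nw] := pselect (A `&` B !=set0); last first.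
    by exists 0 => w Aw Bw; exfalso; apply: nw; exists w.
  exists (g w - g' w) => v Av Bv.
  have gAB : potential (A `&` B) g by apply: potentialS gA => ? [].
  have g'AB : potential (A `&` B) g' by apply: potentialS g'B => ? [].
  have := potential_uniq cAB gAB g'AB (conj Av Bv) (conj Aw Bw); lia.
pose h w := if pselect (A w) then g w else g' w + c.
have hA w : A w -> h w = g w by rewrite /h; case: pselect.
have hB w : B w -> h w = g' w + c.
  by rewrite /h; case: pselect => // Aw Bw; exact: cE.
exists h => p w ABw Uw.
have [Aw|nAw] := pselect (A w).
  near=> v; rewrite !hA //; near: v; first exact: gA.
  exact: open_nbhs_nbhs.
have Bw : B w by case: ABw.
near=> v; rewrite !hB //.
  suff : g' v - f p v = g' w - f p w by lia.
  by near: v; exact: g'B.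
by near: v; exact: open_nbhs_nbhs.
Unshelve. all: by end_near. Qed.

End Potential.


(** * Products and open boxes *)

Lemma near_comp (T1 T2 : topologicalType) (g : T1 -> T2) (V : set T2) x :
  {for x, continuous g} -> (\forall v \near g x, V v) -> \forall u \near x, V (g u).
Proof. by move=> gx Vgx; exact: gx. Qed.

Lemma pairl_continuous (T1 T2 : topologicalType) (y : T2) :
  continuous (fun x : T1 => (x, y)).
Proof. by move=> x; apply: cvg_pair => //; exact: cvg_cst. Qed.

Lemma pairr_continuous (T1 T2 : topologicalType) (x : T1) :
  continuous (fun y : T2 => (x, y)).
Proof. by move=> y; apply: cvg_pair => //; exact: cvg_cst. Qed.

Lemma connectedX (T1 T2 : topologicalType) (A : set T1) (B : set T2) :
  connected A -> connected B -> connected (A `*` B).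
Proof.
move=> cA cB; refine (@near_connected _ (A `*` B) _) => E EAB.
move=> [x y] [x' y'] [/= Ax By] [/= Ax' By'] Exy.
have Ex'y : E (x', y).
  apply: (@connected_near _ A [set u | E (u, y)] cA _ x x') => // u Au.
  have := near_comp (@pairl_continuous _ _ y u) (EAB (u, y) (conj Au By)).
  by apply: filterS => v Ev Av; exact: Ev.
apply: (@connected_near _ B [set u | E (x', u)] cB _ y y') => // u Bu.
have := near_comp (@pairr_continuous _ _ x' u) (EAB (x', u) (conj Ax' Bu)).
by apply: filterS => v Ev Bv; exact: Ev.
Qed.

Section Box.
Variable R : realType.

Definition box (a b c d : R) : set (R * R) :=
  [set p | a < p.1 < b /\ c < p.2 < d].

Lemma open_box a b c d : open (box a b c d).
Proof.
rewrite openE => -[x y] [/= xab ycd]; rewrite /interior.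
exists (`]a, b[%classic, `]c, d[%classic) => /=.
  by split; apply: open_nbhs_nbhs; split; rewrite /= ?in_itv //=; exact: itv_open.
by move=> [u v] [/=]; rewrite !in_itv.
Qed.

Lemma connected_box a b c d : connected (box a b c d).
Proof.
have -> : box a b c d = `]a, b[ `*` `]c, d[.
  by apply/seteqP; split=> -[x y] [/=]; rewrite !in_itv.
by apply: connectedX; apply/connected_intervalP; exact: interval_is_interval.
Qed.

Lemma near_box (p : R * R) (V : set (R * R)) : nbhs p V ->
  exists2 e, 0 < e & box (p.1 - e) (p.1 + e) (p.2 - e) (p.2 + e) `<=` V.
Proof.
move=> /nbhs_ballP[e e0 eV]; exists e => // q [q1 q2]; apply: eV.
by split; rewrite /= -ball_normE /= ltr_distlC.
Qed.

End Box.

Section PlanePotential.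
Variable R : realType.
Variables (U : R * R -> set (R * R)) (f : R * R -> R * R -> int).
Hypothesis U_open : forall p, open (U p).
Hypothesis U_self : forall p, U p p.
Hypothesis f_compat : forall p q w, U p w -> U q w ->
  \forall v \near w, f p v - f q v = f p w - f q w.

(** Each vertical gluing shrinks the width to the smaller of two, so the width stays existentially
    quantified. Only columns of full height are then glued horizontally. *)
Lemma potential_column x a b : exists2 r, 0 < r &
  exists g, potential U f (box (x - r) (x + r) a b) g.
Proof.
apply: (@itv_ind R (fun a b => exists2 r, 0 < r &
  exists g, potential U f (box (x - r) (x + r) a b) g)) => {a b}.
- move=> a b a' b' aa' b'b [r r0 [g Hg]]; exists r => //; exists g.
  by apply: potentialS Hg => -[u v]; rewrite /box /= => -[? ?]; split; lra.
- move=> a b c d ac cb bd [r r0 [g Hg]] [r' r'0 [g' Hg']].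
  pose s := Num.min r r'.
  have [s0 sr sr'] : [/\ 0 < s, s <= r & s <= r'].
    by rewrite lt_min r0 r'0 !ge_min !lexx orbT.
  exists s => //.
  have [] := @potential_glue _ U f U_self (box (x - s) (x + s) a b)
    (box (x - s) (x + s) c d) g g'; try exact: open_box.
  + have -> : box (x - s) (x + s) a b `&` box (x - s) (x + s) c d =
              box (x - s) (x + s) c b; last exact: connected_box.
    by apply/seteqP; split=> -[u v]; rewrite /box /=; [move=> [[? ?] [? ?]]|move=> [? ?]];
      repeat split; lra.
  + by apply: potentialS Hg => -[u v]; rewrite /box /= => -[? ?]; split; lra.
  + by apply: potentialS Hg' => -[u v]; rewrite /box /= => -[? ?]; split; lra.
  move=> h Hh; exists h; apply: potentialS Hh => -[u v]; rewrite /box /= => -[? ?].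
  by have [?|?] := ltP v b; [left|right]; split; lra.
- move=> y.
  have [e e0 eU] := near_box (open_nbhs_nbhs (conj (@U_open (x, y)) (U_self (x, y)))).
  exists e => //; exists e => //; exists (f (x, y)).
  exact: potentialS eU (@potential_local _ _ _ f_compat _).
Qed.

Lemma potential_box a b c d : exists g, potential U f (box a b c d) g.
Proof.
apply: (@itv_ind R (fun a b => exists g, potential U f (box a b c d) g)) => {a b}.
- move=> a b a' b' aa' b'b [g Hg]; exists g.
  by apply: potentialS Hg => -[u v]; rewrite /box /= => -[? ?]; split; lra.
- move=> a b a' b' aa' a'b bb' [g Hg] [g' Hg'].
  have [] := @potential_glue _ U f U_self (box a b c d) (box a' b' c d) g g';
    try exact: open_box; try assumption.
    have -> : box a b c d `&` box a' b' c d = box a' b c d; last exact: connected_box.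
    by apply/seteqP; split=> -[u v]; rewrite /box /=; [move=> [[? ?] [? ?]]|move=> [? ?]];
      repeat split; lra.
  move=> h Hh; exists h; apply: potentialS Hh => -[u v]; rewrite /box /= => -[? ?].
  by have [?|?] := ltP u b; [left|right]; split; lra.
- move=> x; have [r r0 [g Hg]] := potential_column x c d; by exists r => //; exists g.
Qed.

Lemma potential_plane : exists g, potential U f setT g.
Proof.
pose B (n : nat) := box (- n.+1%:R) n.+1%:R (- n.+1%:R) n.+1%:R : set (R * R).
have [g0 g0B] := choice (fun n => potential_box (- n.+1%:R) n.+1%:R (- n.+1%:R) n.+1%:R).
(* Potentials on nested boxes agree up to a constant; fixing the value 0 at the origin removes
   it. *)
pose g n v := g0 n v - g0 n 0.
have gB n : potential U f (B n) (g n) by exact: potential_shift (g0B n).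
have B0 n : B n 0.
  have : 0 < n.+1%:R :> R by rewrite ltr0n.
  by rewrite /B /box /=; split; lra.
have BS m n : (m <= n)%N -> B m `<=` B n.
  rewrite -ltnS -(ler_nat R) => mn [u v]; rewrite /B /box /= => -[? ?]; split; lra.
have gE m n v : (m <= n)%N -> B m v -> g m v = g n v.
  move=> mn Bv; have := potential_uniq U_self (@connected_box _ _ _ _ _)
    (gB m) (potentialS (BS _ _ mn) (gB n)) Bv (B0 m).
  rewrite /g; lia.
have gE' m n v : B m v -> B n v -> g m v = g n v.
  by case: (leqP m n) => [|/ltnW] mn Bm Bn; [apply: gE|apply/esym/gE].
have /choice[N NB] : forall v, exists n, B n v.
  move=> [u v].
  exists (Num.truncn (`|u| + `|v|)); rewrite /B /box /=.
  have := truncnS_gt (`|u| + `|v|); set k := _.+1%:R => kuv.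
  have := normr_ge0 u; have := normr_ge0 v.
  have := ler_norm u; have := ler_norm v.
  have := ler_norm (- u); have := ler_norm (- v); rewrite !normrN.
  by move=> *; split; lra.
exists (fun v => g (N v) v) => p w _ Uw.
near=> v; rewrite (gE' _ (N w) v) //; near: v; first exact: gB.
exact: (open_nbhs_nbhs (conj (@open_box _ _ _ _ _) (NB w))).
Unshelve. all: by end_near. Qed.

End PlanePotential.

Lemma potential_homeomorphic (R : realType) (P : topologicalType)
    (U : P -> set P) (f : P -> P -> int) :
  homeomorphic P (R * R)%type ->
  (forall p, open (U p)) -> (forall p, U p p) ->
  (forall p q w, U p w -> U q w ->
    \forall v \near w, f p v - f q v = f p w - f q w) ->
  exists g, potential U f setT g.
Proof.
move=> [h [k [ch ck hK kH]]] oU UU fU.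
have := @potential_plane R (fun v => k @^-1` U (k v)) (fun v w => f (k v) (k w)).
case.
- by move=> p; apply: open_comp => // ? _; exact: ck.
- by move=> p; exact: UU.
- by move=> p q w Up Uq; have := near_comp (@ck w) (fU _ _ _ Up Uq).
move=> g Hg; exists (g \o h) => p w _ Uw.
have := Hg (h p) (h w) I; rewrite /= !hK => /(_ Uw) /(near_comp (@ch w)).
by apply: filterS => v /=; rewrite hK.
Qed.

Lemma connected_homeomorphic (R : realType) (P : topologicalType) :
  homeomorphic P (R * R)%type -> connected [set: P].
Proof.
move=> [h [k [ch ck hK kH]]].
have -> : [set: P] = k @` [set: R * R].
  by apply/seteqP; split=> // x _; exists (h x).
apply: connected_continuous_connected; last by apply: continuous_subspaceT.
rewrite -setXTT; apply: connectedX; by apply/connected_intervalP => ? *.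
Qed.

Lemma hausdorff_homeomorphic (R : realType) (P : topologicalType) :
  homeomorphic P (R * R)%type -> hausdorff_space P.
Proof.
move=> [h [k [ch ck hK kH]]].
rewrite open_hausdorff => p q pq.
have hpq : h p != h q by apply: contraNN pq => /eqP/(can_inj hK) ->.
have H : hausdorff_space (R * R)%type by exact: norm_hausdorff.
rewrite open_hausdorff in H.
have [[U V] /= [Up Vq] [oU oV UV]] := H _ _ hpq.
exists (h @^-1` U, h @^-1` V) => /=; first by rewrite !inE in Up Vq *.
split; [by apply: open_comp => // ? _; exact: ch| by apply: open_comp => // ? _; exact: ch|].
by rewrite -preimage_setI (eqP UV) preimage_set0.
Qed.

(** * Cutting connected sets along leaves *)

Section Cut.
Variable T : topologicalType.

(* [D1] is one side of [Z] in [D]: near [Z] it is locally connected, so the type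
   of a hypothetical clopen piece of [D1] is constant along [Z]. *)
Lemma connected_cut (D D1 Z : set T) : connected D -> connected Z ->
    Z `<=` D -> Z !=set0 -> open D1 -> (forall z, Z z -> ~ D1 z) ->
    (forall p, D p -> ~ D1 p -> ~ Z p -> \forall q \near p, ~ D1 q) ->
    (forall z, Z z -> exists O, [/\ open O, O z, connected (O `&` D1) & closure D1 z]) ->
  D1 `<=` D -> connected D1.
Proof.
move=> cD cZ ZD [z0 Zz0] oD1 ZD1 nearD1 ZO D1D.
refine (@near_connected _ D1 _) => E ED1.
(* If [F] holds on [D1] near [Z], the part of [D1] where it fails is open and closed in [D] and
   misses [z0], hence is empty. The boolean lets [F] be [E] or its negation. *)
have sideE (b : bool) (F := fun q => if b then E q else ~ E q) :
    (forall z, Z z -> \forall q \near z, D1 q -> F q) -> forall p, D1 p -> F p.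
  move=> ZF p D1p; apply: contrapT => nFp.
  have FE q r : (E q <-> E r) -> (~ F q <-> ~ F r) by rewrite /F; case: b {F ZF nFp} => ->.
  suff [] : (D1 `&` (~` F)) z0 by move=> /(ZD1 _ Zz0).
  apply: (@connected_near _ D (D1 `&` (~` F)) cD _ p z0) => //; [|exact: D1D|exact: ZD].
  move=> q Dq; have [D1q|nD1q] := pselect (D1 q).
    near=> r => _; have D1r : D1 r by near: r; exact: open_nbhs_nbhs.
    have Erq : E r <-> E q by move: (D1r); near: r; exact: ED1.
    by split=> -[_ /(FE _ _ Erq)].
  have [Zq|nZq] := pselect (Z q); near=> r => _.
    split=> -[] //; suff : D1 r -> F r by move=> + /[dup] D1r => /[apply].
    by near: r; exact: ZF.
  split=> -[] // D1r _; suff : ~ D1 r by [].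
  by near: r; exact: nearD1.
have dich z : Z z -> (\forall q \near z, D1 q -> E q) \/ (\forall q \near z, D1 q -> ~ E q).
  move=> Zz; have [O [oO Oz cO _]] := ZO z Zz.
  have cE := connected_near cO _.
  have EO p q : (O `&` D1) p -> (O `&` D1) q -> E p -> E q.
    apply: cE => r [Or D1r]; apply: filterS (ED1 r D1r) => s + [_]; exact.
  have [[p Op Ep]|nE] := pselect (exists2 p, (O `&` D1) p & E p); [left|right]; near=> q => D1q.
    by apply: EO Ep => //; split=> //; near: q; exact: open_nbhs_nbhs.
  by move=> Eq; apply: nE; exists q => //; split=> //; near: q; exact: open_nbhs_nbhs.
pose M := [set z | D1 z -> E z]°; pose M' := [set z | D1 z -> ~ E z]°.
have MM' z : Z z -> M z -> M' z -> False.
  move=> Zz Mz M'z; have [_ [_ _ _ clz]] := ZO z Zz.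
  by have [w [D1w [/(_ D1w) Ew /(_ D1w)]]] := clz _ (filterI Mz M'z).
have MZ z z' : Z z -> Z z' -> M z -> M z'.
  apply: (@connected_near _ Z M cZ) => w Zw.
  have [Mw|M'w] := dich w Zw; near=> r => Zr.
    by split=> // _; near: r; apply: open_nbhs_nbhs; split=> //; exact: open_interior.
  split; last by move=> Mw; have := MM' _ Zw Mw M'w.
  have M'r : M' r by near: r; apply: open_nbhs_nbhs; split=> //; exact: open_interior.
  by move=> Mr; have := MM' _ Zr Mr M'r.
move=> p q D1p D1q Ep; have [Mz0|M'z0] := dich z0 Zz0.
  by apply: (sideE true) D1q => z Zz; exact: MZ Mz0.
exfalso; apply: (sideE false _ p D1p Ep) => z Zz.
have [Mz|//] := dich z Zz; have Mz0 := MZ _ _ Zz Zz0 Mz.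
by have := MM' _ Zz0 Mz0 M'z0.
Unshelve. all: by end_near. Qed.

End Cut.

(** * Orders along leaves and product charts *)

Section Lines.
Variables (R : realType) (P : topologicalType).
Implicit Types (lt : P -> P -> Prop) (p q : P).

Definition leaf lt p : set P := [set q | q = p \/ lt p q \/ lt q p].

Definition line_order lt := forall p, exists gamma : R -> P,
  [/\ continuous gamma, range gamma = leaf lt p
    & forall s t, lt (gamma s) (gamma t) <-> s < t].

Variable lt : P -> P -> Prop.
Hypothesis lt_line : line_order lt.

Lemma leaf_refl p : leaf lt p p. Proof. by left. Qed.

Lemma leaf_sym p q : leaf lt p q -> leaf lt q p.
Proof. by move=> [->|[|]]; [left|right; right|right; left]. Qed.

Lemma leaf_lt p q : lt p q -> leaf lt p q. Proof. by right; left. Qed.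

Lemma leaf_gt p q : lt q p -> leaf lt p q. Proof. by right; right. Qed.

Lemma leaf_point p q : leaf lt p q -> exists gamma : R -> P, exists s t,
  [/\ continuous gamma, range gamma = leaf lt p,
      forall s t, lt (gamma s) (gamma t) <-> s < t,
      gamma s = p & gamma t = q].
Proof.
move=> pq; have [gamma [cg rg gP]] := lt_line p; exists gamma.
have : range gamma p by rewrite rg; exact: leaf_refl.
have : range gamma q by rewrite rg.
by move=> [t _ tE] [s _ sE]; exists s, t.
Qed.

Lemma lto_irr p : ~ lt p p.
Proof.
have [g [s [t [_ _ gP <- _]]]] := leaf_point (leaf_refl p).
by move=> /gP; rewrite ltxx.
Qed.

Lemma leaf_total p q r : leaf lt p q -> leaf lt p r -> leaf lt q r.
Proof.
have [gamma [cg rg gP]] := lt_line p; rewrite -rg => -[s _ <-] [t _ <-].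
by have [st|ts|->] := ltgtP s t; [right; left; apply/gP|right; right; apply/gP|left].
Qed.

Lemma leaf_trans p q r : leaf lt p q -> leaf lt q r -> leaf lt p r.
Proof. by move=> /leaf_sym; exact: leaf_total. Qed.

Lemma leaf_eq p q : leaf lt p q -> leaf lt p = leaf lt q.
Proof.
by move=> pq; apply/seteqP; split=> r; [exact: leaf_total|exact: leaf_trans].
Qed.

Lemma lto_trans p q r : lt p q -> lt q r -> lt p r.
Proof.
move=> pq qr; have [gamma [cg rg gP]] := lt_line q.
have : range gamma p by rewrite rg; exact: leaf_gt.
have : range gamma q by rewrite rg; exact: leaf_refl.
have : range gamma r by rewrite rg; exact: leaf_lt.
move=> [u _ uE] [v _ vE] [w _ wE]; move: pq qr; rewrite -uE -vE -wE => /gP st /gP tu.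
by apply/gP; exact: lt_trans tu.
Qed.

Lemma lto_asym p q : lt p q -> ~ lt q p.
Proof. by move=> pq qp; apply: (@lto_irr p); exact: lto_trans qp. Qed.

Lemma exists_gt p : exists q, lt p q.
Proof.
have [g [s [t [_ _ gP <- _]]]] := leaf_point (leaf_refl p).
by exists (g (s + 1)); apply/gP; rewrite ltrDl.
Qed.

Lemma exists_lt p : exists q, lt q p.
Proof.
have [g [s [t [_ _ gP <- _]]]] := leaf_point (leaf_refl p).
by exists (g (s - 1)); apply/gP; rewrite gtrDl oppr_lt0.
Qed.

Lemma exists_between p q : lt p q -> exists2 r, lt p r & lt r q.
Proof.
move=> pq; have [g [s [t [_ _ gP sE tE]]]] := leaf_point (leaf_lt pq).
move: pq; rewrite -sE -tE => /gP st; exists (g ((s + t) / 2)); apply/gP; lra.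
Qed.

Lemma connected_leaf p : connected (leaf lt p).
Proof.
have [g [cg <- _]] := lt_line p.
apply: connected_continuous_connected; last exact: continuous_subspaceT.
by apply/connected_intervalP => ? *.
Qed.

Lemma connected_lt_itv p q : leaf lt p q -> connected [set r | lt p r /\ lt r q].
Proof.
move=> pq; have [g [s [t [cg rg gP sE tE]]]] := leaf_point pq.
have -> : [set r | lt p r /\ lt r q] = g @` `]s, t[.
  apply/seteqP; split=> [r [pr rq]|_ [u + <-]].
    have : range g r by rewrite rg; exact: leaf_lt.
    move=> [u _ uE]; exists u => //; move: pr rq; rewrite -uE -sE -tE => /gP su /gP ut.
    by rewrite /= in_itv /= su.
  by rewrite /= in_itv /= => /andP[su ut]; rewrite -sE -tE; split; apply/gP.
apply: connected_continuous_connected; last exact: continuous_subspaceT.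
by apply/connected_intervalP; exact: interval_is_interval.
Qed.

End Lines.
Arguments connected_leaf {R P lt} lt_line p.
Arguments leaf_refl {P lt} p.

Section Structure.
Variables (R : realType) (P : topologicalType).
Implicit Types lt : P -> P -> Prop.

(* A foliation is represented by the strict order along its leaves alone; its
   leaves are then the classes [leaf lt p]. *)
Record product_chart lt1 lt2 (psi : R * R -> P) : Prop := ProductChart {
  pc_continuous : continuous psi;
  pc_inj : injective psi;
  pc_open : forall V, open V -> open (psi @` V);
  pc_lt1 : forall x x' y, x < x' -> lt1 (psi (x, y)) (psi (x', y));
  pc_lt2 : forall x y y', y < y' -> lt2 (psi (x, y)) (psi (x, y'));
  pc_straight1 : forall A p, connected A -> A `<=` range psi ->
    A `<=` leaf lt1 p -> forall u v, A (psi u) -> A (psi v) -> u.2 = v.2;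
  pc_straight2 : forall A p, connected A -> A `<=` range psi ->
    A `<=` leaf lt2 p -> forall u v, A (psi u) -> A (psi v) -> u.1 = v.1
}.

(** The working form of a bifoliated plane. The last two clauses of [bf_chart] forbid the two leaves
    of the centre to return to the chart; for other leaves only connected pieces are controlled, by
    [pc_straight1] and [pc_straight2]. The conditions are symmetric, so each result on one foliation
    holds for the other by [bifoliated_swap]. *)
Record bifoliated lt1 lt2 : Prop := Bifoliated {
  bf_plane : homeomorphic P (R * R)%type;
  bf_line1 : line_order R lt1;
  bf_line2 : line_order R lt2;
  bf_closed1 : forall p, closed (leaf lt1 p);
  bf_closed2 : forall p, closed (leaf lt2 p);
  bf_chart : forall p O, nbhs p O -> exists psi, [/\ product_chart lt1 lt2 psi,
    psi 0 = p, range psi `<=` O, forall u, leaf lt1 p (psi u) -> u.2 = 0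
    & forall u, leaf lt2 p (psi u) -> u.1 = 0]
}.

Definition swap (u : R * R) : R * R := (u.2, u.1).

Lemma swap_continuous : continuous swap.
Proof.
move=> [x y]; apply: (@cvg_pair _ _ _ _ (nbhs y) (nbhs x)); first exact: cvg_snd.
exact: cvg_fst.
Qed.

Lemma swapK : involutive swap. Proof. by case. Qed.

Lemma product_chart_swap lt1 lt2 psi :
  product_chart lt1 lt2 psi -> product_chart lt2 lt1 (psi \o swap).
Proof.
move=> [cpsi ipsi opsi lt1P lt2P s1 s2].
have rE : range (psi \o swap) = range psi.
  apply/seteqP; split=> _ [u _ <-]; first by exists (swap u).
  by exists (swap u) => //=; rewrite swapK.
split.
- by move=> u; apply: continuous_comp; [exact: swap_continuous|exact: cpsi].
- by move=> [x y] [x' y'] /ipsi[-> ->].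
- move=> V oV; rewrite -image_comp; apply: opsi.
  have -> : swap @` V = swap @^-1` V.
    apply/seteqP; split=> u /=; first by move=> [v Vv <-]; rewrite swapK.
    by move=> Vu; exists (swap u) => //; rewrite swapK.
  by apply: open_comp => // u _; exact: swap_continuous.
- by move=> x x' y xx' /=; exact: lt2P.
- by move=> x x' y xx' /=; exact: lt1P.
- by rewrite rE => A p cA Ar Al u v Au Av; exact: (s2 A p cA Ar Al (swap u) (swap v)).
- by rewrite rE => A p cA Ar Al u v Au Av; exact: (s1 A p cA Ar Al (swap u) (swap v)).
Qed.

Lemma bifoliated_swap lt1 lt2 : bifoliated lt1 lt2 -> bifoliated lt2 lt1.
Proof.
move=> [h l1 l2 c1 c2 ch]; split=> // p O /ch[psi [pc p0 rO x1 x2]].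
exists (psi \o swap); split=> //; first exact: product_chart_swap.
- by move=> _ [u _ <-]; apply: rO; exists (swap u).
- by move=> u /x2.
- by move=> u /x1.
Qed.

Section Chart.
Variables (lt1 lt2 : P -> P -> Prop) (psi : R * R -> P).
Hypotheses (l1 : line_order R lt1) (l2 : line_order R lt2).
Hypothesis pc : product_chart lt1 lt2 psi.

Lemma open_range_chart : open (range psi).
Proof. by apply: (pc_open pc); exact: openT. Qed.

Lemma chart_leaf1 x x' y : leaf lt1 (psi (x, y)) (psi (x', y)).
Proof.
have [xx'|x'x|->] := ltgtP x x'; last exact: leaf_refl.
  by apply: leaf_lt; exact: (pc_lt1 pc).
by apply: leaf_gt; exact: (pc_lt1 pc).
Qed.

Lemma chart_leaf2 x y y' : leaf lt2 (psi (x, y)) (psi (x, y')).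
Proof.
have [xx'|x'x|->] := ltgtP y y'; last exact: leaf_refl.
  by apply: leaf_lt; exact: (pc_lt2 pc).
by apply: leaf_gt; exact: (pc_lt2 pc).
Qed.

Lemma chart_lt2 x y y' : lt2 (psi (x, y)) (psi (x, y')) <-> y < y'.
Proof.
split; last exact: (pc_lt2 pc).
have [//|y'y|->] := ltgtP y y'; last by move=> /(lto_irr l2).
by move=> /(lto_asym l2); have := pc_lt2 pc x y'y.
Qed.

End Chart.

End Structure.
Arguments bf_chart {R P lt1 lt2} b {p O}.

Lemma open_snd (R : realType) (D : set R) : open D -> open [set u : R * R | D u.2].
Proof.
move=> oD; have -> : [set u : R * R | D u.2] = snd @^-1` D by [].
by apply: open_comp => // ? _; exact: cvg_snd.
Qed.

(** * The two sides of a leaf *)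

Section Sides.
Variables (R : realType) (P : topologicalType).
Implicit Types (lt : P -> P -> Prop) (U : set P).

(** The opposite side is the complement of [U] and the leaf. The last two clauses say which of the
    two sides is meant: the one that [lt2] enters. *)
Definition is_side lt1 lt2 (l : P) U :=
  [/\ open U, open (~` (U `|` leaf lt1 l)),
      forall q, leaf lt1 l q -> ~ U q,
      forall q x, leaf lt1 l q -> lt2 q x -> U x
    & forall q x, leaf lt1 l q -> lt2 x q -> ~ (U `|` leaf lt1 l) x].

Variables lt1 lt2 : P -> P -> Prop.
Hypothesis B : bifoliated R lt1 lt2.
Let l1 := bf_line1 B.
Let l2 := bf_line2 B.

Section ExistsSide.
Variable l : P.
Let L := leaf lt1 l.
Variable psi : P -> R * R -> P.
Hypothesis psi_chart : forall p, product_chart lt1 lt2 (psi p).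
Hypothesis psi0 : forall p, psi p 0 = p.
Hypothesis psi_axis : forall p u, leaf lt1 p (psi p u) -> u.2 = 0.

Let U p := if `[< L p >] then range (psi p) else ~` L.
(** The jump across [L], seen in the chart at [p]. It is discontinuous only on [L], so compatibility
    is a question about charts centred on [L]. *)
Let f p v : int := if `[< L p /\ exists u, psi p u = v /\ 0 < u.2 >] then 1 else 0.

Let open_U p : open (U p).
Proof.
rewrite /U; case: asboolP => _; first exact: open_range_chart (psi_chart p).
by rewrite openC; exact: (bf_closed1 B).
Qed.

Let U_self p : U p p.
Proof. by rewrite /U; case: asboolP => // _; exists 0. Qed.

Let f_off p w : U p w -> ~ L w -> \forall v \near w, f p v = f p w.
Proof.
rewrite /U; case: asboolP => [Lp [[x y] _ <-]|nLp _] nLw; last first.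
  near=> v; rewrite /f.
  by do 2![case: asboolP => [[]//|_]].
have y0 : y != 0.
  apply/eqP => y0; apply: nLw; apply: (leaf_trans l1 Lp).
  by rewrite -[X in leaf _ X](psi0 p) y0; exact: (chart_leaf1 (psi_chart p)).
have fE u : f p (psi p u) = if 0 < u.2 then 1 else 0.
  rewrite /f; case: asboolP => [[_ [u' [/(pc_inj (psi_chart p)) ->] ->]] //|nu].
  by case: ltP => // u0; exfalso; apply: nu; split=> //; exists u.
have open_half (H : set (R * R)) : open H -> H (x, y) ->
    \forall v \near psi p (x, y), exists2 u, H u & psi p u = v.
  by move=> oH Hxy; apply: open_nbhs_nbhs; split; [exact: (pc_open (psi_chart p))|exists (x, y)].
move: y0; rewrite neq_lt => /orP[y0|y0].
  have : \forall v \near psi p (x, y), exists2 u, [set u | u.2 < 0] u & psi p u = v.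
    by apply: open_half => //; apply: (@open_snd R [set y | y < 0]); exact: open_lt.
  by apply: filterS => _ [u /= u0 <-]; rewrite !fE /=; case: ltgtP u0 y0 => // _ _; case: ltgtP.
have : \forall v \near psi p (x, y), exists2 u, [set u | 0 < u.2] u & psi p u = v.
  by apply: open_half => //; apply: (@open_snd R [set y | 0 < y]); exact: open_gt.
by apply: filterS => _ [u /= u0 <-]; rewrite !fE /= u0 y0.
Unshelve. all: by end_near. Qed.

(** A vertical line of [phi] is connected, hence lies on one vertical line of [psi p]. Its foot is
    on [L], where the second coordinate of [psi p] vanishes, and the order [lt2] carries the sign
    from one chart to the other. *)
Let f_on p w (phi : R * R -> P) : U p w -> L w -> product_chart lt1 lt2 phi ->
  range phi `<=` U p -> phi 0 = w ->
  forall u, f p (phi u) = if 0 < u.2 then 1 else 0.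
Proof.
rewrite /U; case: asboolP => // Lp [u0 _ u0w] Lw cphi rphi phi0 [a b] /=.
have Lfoot : L (phi (a, 0)).
  by apply: (leaf_trans l1 Lw); rewrite -phi0; exact: (chart_leaf1 cphi).
have [[x0 y0] _ footE] : range (psi p) (phi (a, 0)) by apply: rphi; exists (a, 0).
have y00 : y0 = 0.
  by apply: (@psi_axis p (x0, y0)); rewrite footE; exact: (leaf_total l1 Lp Lfoot).
have [[x1 y1] _ vE] : range (psi p) (phi (a, b)) by apply: rphi; exists (a, b).
have x1E : x1 = x0.
  pose A := phi @` [set u | u.1 = a].
  have cA : connected A.
    have -> : A = (fun y => phi (a, y)) @` setT.
      apply/seteqP; split=> _ [u + <-]; last by exists (a, u).
      by move=> /= <-; exists u.2 => //; case: u.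
    apply: connected_continuous_connected; first by apply/connected_intervalP => ? *.
    apply: continuous_subspaceT => y; apply: continuous_comp; first exact: pairr_continuous.
    exact: (pc_continuous cphi).
  have Ar : A `<=` range (psi p) by move=> _ [u _ <-]; apply: rphi; exists u.
  have Al : A `<=` leaf lt2 (phi (a, 0)).
    by move=> _ [[u v] /= -> <-]; exact: (chart_leaf2 cphi).
  have := pc_straight2 (psi_chart p) cA Ar Al (u := (x1, y1)) (v := (x0, y0)).
  by apply; rewrite ?vE ?footE; [exists (a, b)|exists (a, 0)].
have pos : 0 < y1 <-> 0 < b.
  rewrite -(chart_lt2 l2 (psi_chart p) x0 0 y1) -(chart_lt2 l2 cphi a 0 b).
  by rewrite -vE -footE x1E y00.
rewrite /f; case: asboolP => [[_ [u [uE u20]]]|nu].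
  move: uE; rewrite -vE => /(pc_inj (psi_chart p)) uE.
  by move: u20; rewrite uE /= => /pos ->.
by case: ltP => // /pos y10; exfalso; apply: nu; split=> //; exists (x1, y1).
Qed.

Let f_compat p q w : U p w -> U q w ->
  \forall v \near w, f p v - f q v = f p w - f q w.
Proof.
move=> Up Uq; have [Lw|nLw] := pselect (L w); last first.
  by near=> v; congr (_ - _); near: v; exact: f_off.
have Upq : nbhs w (U p `&` U q).
  by apply: filterI; apply: open_nbhs_nbhs; split=> //; exact: open_U.
have [phi [cphi phi0 rphi _ _]] := bf_chart B Upq.
have fE p' : U p' w -> range phi `<=` U p' -> forall u, f p' (phi u) = if 0 < u.2 then 1 else 0.
  by move=> Up' rp'; exact: f_on Up' Lw cphi rp' phi0.
have fpE := fE p Up (fun v rv => (rphi v rv).1).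
have fqE := fE q Uq (fun v rv => (rphi v rv).2).
have : \forall v \near w, range phi v.
  by apply: open_nbhs_nbhs; split; [exact: open_range_chart cphi|exists 0].
by apply: filterS => _ [u _ <-]; rewrite -phi0 !fpE !fqE !subrr.
Unshelve. all: by end_near. Qed.

(** The local jumps glue to a function [s] that vanishes on [L], equals the local jump near [L] and
    is locally constant elsewhere. By connectedness its only values are 0 and 1, and the side is
    where it is 1. *)
Lemma exists_side_aux : exists U, is_side lt1 lt2 l U.
Proof.
have [g gP] := potential_homeomorphic (bf_plane B) open_U U_self f_compat.
have fself p u : L p -> f p (psi p u) = if 0 < u.2 then 1 else 0.
  move=> Lp; apply: (@f_on p p (psi p) (U_self p) Lp (psi_chart p) _ (psi0 p)).
  by rewrite /U; case: asboolP => // _ v.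
have near_psi p : \forall v \near p, range (psi p) v.
  by apply: open_nbhs_nbhs; split; [exact: open_range_chart|exists 0].
have gL p : L p -> \forall v \near p, g v = g p + f p v.
  move=> Lp; have := gP p p I (U_self p); apply: filterS => v.
  have := fself p 0 Lp; rewrite psi0 /= ltxx => ->; lia.
have goff p : ~ L p -> \forall v \near p, g v = g p.
  move=> nLp; have := gP p p I (U_self p); apply: filterS => v.
  by rewrite /f; do 2![case: asboolP => [[]//|_]]; rewrite !subr0.
have gl p : L p -> g p = g l.
  move=> Lp; suff : [set v | g v = g l] p by [].
  apply: (@connected_near _ L [set v | g v = g l] (connected_leaf l1 l) _ l p) => //; last exact: leaf_refl.
  move=> q Lq; near=> r => Lr /=; suff -> : g r = g q by [].
  have -> : g r = g q + f q r by near: r; exact: gL.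
  have [u _ ur] : range (psi q) r by near: r; exact: near_psi.
  rewrite -ur fself // (@psi_axis q) ?ltxx ?addr0 //.
  by rewrite ur; exact: (leaf_total l1 Lq Lr).
pose s v := g v - g l.
have sL p : L p -> s p = 0 by move=> /gl; rewrite /s => ->; rewrite subrr.
have s_near p : L p -> \forall v \near p, s v = f p v.
  by move=> Lp; apply: filterS (gL p Lp) => v; rewrite /s => ->; rewrite (gl p Lp); lia.
have s_off p : ~ L p -> \forall v \near p, s v = s p.
  by move=> nLp; apply: filterS (goff p nLp) => v; rewrite /s => ->.
have f01 p v : f p v = 0 \/ f p v = 1 by rewrite /f; case: asboolP; [right|left].
have s01 v : s v = 0 \/ s v = 1.
  apply: (@connected_near _ setT [set v | s v = 0 \/ s v = 1] (connected_homeomorphic (bf_plane B)) _ l v) => //.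
    move=> p _; have [Lp|nLp] := pselect (L p).
      apply: filterS (s_near p Lp) => q /= -> _; split=> _; last exact: f01.
      by left; exact: sL.
    by apply: filterS (s_off p nLp) => q /= ->.
  by left; apply: sL; exact: leaf_refl.
have crossing (gm : R -> P) t : continuous gm -> (forall u v, lt2 (gm u) (gm v) <-> u < v) ->
    L (gm t) -> range gm = leaf lt2 (gm t) ->
    exists2 e, 0 < e & forall u, t - e < u < t + e -> s (gm u) = if t < u then 1 else 0.
  move=> cgm gmP Lt rgm; set p := gm t.
  have nearP : \forall u \near t, s (gm u) = f p (gm u) /\ range (psi p) (gm u).
    have H : \forall v \near p, s v = f p v /\ range (psi p) v.
      by near=> v; split; near: v; [exact: s_near|exact: near_psi].
    exact: near_comp (cgm t) H.
  have [/= e e0 eP] := (nbhs_ballP t _).1 nearP.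
  have {}eP u : t - e < u < t + e -> s (gm u) = f p (gm u) /\ range (psi p) (gm u).
    by move=> te; apply: eP; rewrite -ball_normE /= ltr_distlC.
  exists e => // u tu; have [-> [[x y] _ xyE]] := eP u tu.
  have tt : t - e < t < t + e by lra.
  pose A := gm @` `]t - e, t + e[.
  have cA : connected A.
    apply: connected_continuous_connected; last exact: continuous_subspaceT.
    by apply/connected_intervalP; exact: interval_is_interval.
  have Ar : A `<=` range (psi p).
    by move=> _ [v + <-]; rewrite /= in_itv /= => /eP[].
  have Al : A `<=` leaf lt2 p by rewrite -rgm => _ [v _ <-]; exists v.
  have x0 : x = 0.
    have := pc_straight2 (psi_chart p) cA Ar Al (u := (x, y)) (v := (0, 0)).
    apply; first by rewrite xyE; exists u => //=; rewrite in_itv.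
    by rewrite [psi p _]psi0; exists t => //=; rewrite in_itv.
  rewrite -xyE fself //=.
  have : 0 < y <-> t < u.
    rewrite -(chart_lt2 l2 (psi_chart p) 0 0 y) -gmP.
    by rewrite [psi p (0, 0)]psi0 -{1}x0 xyE.
  by case: (ltP 0 y) => _; case: (ltP t u) => _ // [H1 H2]; [have := H1 isT|have := H2 isT].
(* Along a leaf of the second foliation [s] is locally constant off [L] and steps from 0 up to 1 at
   each crossing. It can therefore never decrease, so a second crossing, where [s] would be 0 again,
   is impossible. *)
have mono x y : lt2 x y -> s x <= s y.
  move=> xy; have [gm [a [b [cgm rgm gmP xE yE]]]] := leaf_point l2 (leaf_lt xy).
  move: xy; rewrite -xE -yE => /gmP ab.
  pose Q (a b : R) := forall u v, a < u -> u <= v -> v < b -> s (gm u) <= s (gm v).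
  suff /(_ (a - 1) (b + 1)) : forall a b, Q a b by apply; lra.
  apply: itv_ind.
  - by move=> a1 b1 a2 b2 aa bb Q1 u v au uv vb; apply: Q1 => //; lra.
  - move=> a1 b1 c d ac cb bd Q1 Q2 u v au uv vd.
    have [vb|bv] := ltP v b1; first exact: Q1.
    have [cu|uc] := ltP c u; first exact: Q2.
    by apply: (@le_trans _ _ (s (gm ((c + b1) / 2)))); [apply: Q1|apply: Q2]; lra.
  - move=> t; have [Lt|nLt] := pselect (L (gm t)).
      have rgt : range gm = leaf lt2 (gm t).
        by rewrite rgm; apply: (leaf_eq l2); rewrite -rgm; exists t.
      have [e e0 eP] := crossing gm t cgm gmP Lt rgt.
      exists e => // u v tu uv vt; rewrite !eP; try by apply/andP; split; lra.
      by case: (ltP t u) => [tu'|_]; [rewrite (lt_le_trans tu' uv)|case: ifP].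
    have nearP := near_comp (cgm t) (s_off _ nLt).
    have [/= e e0 eP] := (nbhs_ballP t _).1 nearP.
    exists e => // u v tu uv vt; rewrite eP ?eP // -ball_normE /= ltr_distlC; lra.
have above q x : L q -> lt2 q x -> s x = 1.
  move=> Lq qx; have [gm [a [b [cgm rgm gmP qE xE]]]] := leaf_point l2 (leaf_lt qx).
  have [e e0 eP] : exists2 e, 0 < e & forall u, a - e < u < a + e -> s (gm u) = if a < u then 1 else 0.
    by apply: crossing; rewrite ?qE.
  move: qx; rewrite -qE -xE => /gmP ab.
  pose m := Num.min ((a + b) / 2) (a + e / 2).
  have [am mb me] : [/\ a < m, m < b & m < a + e].
    by rewrite /m lt_min !gt_min; split; lra.
  have : s (gm m) <= s (gm b) by apply: mono; exact/gmP.
  rewrite eP ?am; last by lra.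
  by have [->|->] := s01 (gm b).
exists [set v | s v = 1]; split.
- rewrite openE => v /= sv; have nLv : ~ L v by move=> /sL; rewrite sv.
  by apply: filterS (s_off v nLv) => w /= ->.
- rewrite openE => v nv; have nLv : ~ L v by move=> Lv; apply: nv; right.
  have nsv : s v <> 1 by move=> sv; apply: nv; left.
  have oL : open (~` L) by rewrite openC; exact: (bf_closed1 B).
  have nL : \forall w \near v, (~` L) w by exact: open_nbhs_nbhs.
  by apply: filterS2 nL (s_off v nLv) => w nLw sw []; rewrite /= ?sw.
- by move=> q /sL /= ->.
- by move=> q x; exact: above.
- move=> q x Lq xq [sx|Lx].
    have := mono _ _ xq; rewrite (sL q Lq).
    by move: sx => /= ->.
  by have := above x q Lx xq; rewrite (sL q Lq).
Unshelve. all: by end_near. Qed.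

End ExistsSide.

Lemma exists_side l : exists U, is_side lt1 lt2 l U.
Proof.
have chartP : forall p, exists psi : R * R -> P, [/\ product_chart lt1 lt2 psi, psi 0 = p
    & forall u, leaf lt1 p (psi u) -> u.2 = 0].
  by move=> p; have [psi [? ? _ ? _]] := bf_chart B (@filterT _ (nbhs p) _); exists psi.
have [psi psiP] := choice chartP.
by apply: (@exists_side_aux l psi) => p; have [] := psiP p.
Qed.

End Sides.

(** * Calculus of the two sides *)

Section SideTheory.
Variables (R : realType) (P : topologicalType).
Implicit Types (lt : P -> P -> Prop) (U D K : set P).

(** The union of all sides, which by [side_uniq] is the only one. With no choice involved,
    automorphisms preserve it. *)
Definition above lt1 lt2 (l : P) : set P :=
  [set q | exists2 U, is_side lt1 lt2 l U & U q].

Definition below lt1 lt2 (l : P) : set P :=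
  ~` (above lt1 lt2 l `|` leaf lt1 l).

Variables lt1 lt2 : P -> P -> Prop.
Hypothesis B : bifoliated R lt1 lt2.
Let l1 := bf_line1 B.
Let l2 := bf_line2 B.

Lemma exists_chart p O : nbhs p O -> exists psi : R * R -> P,
  [/\ product_chart lt1 lt2 psi, psi 0 = p & range psi `<=` O].
Proof. by move=> /(bf_chart B)[psi [? ? ? _ _]]; exists psi. Qed.

(** The leaf meets [D] in a connected set, and near it a small chart splits into two connected
    halves, so [connected_cut] applies to each side. *)
Lemma side_cut l U D : is_side lt1 lt2 l U -> open D -> connected D ->
    connected (D `&` leaf lt1 l) -> D `&` leaf lt1 l !=set0 ->
  connected (D `&` U) /\ connected (D `&` ~` (U `|` leaf lt1 l)).
Proof.
move=> [oU oD LU abU beU] openD cD cDl Dl0; set L := leaf lt1 l.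
have chartE z : D z -> L z -> exists psi : R * R -> P, [/\ product_chart lt1 lt2 psi,
    psi 0 = z, range psi `<=` D, (range psi `&` U = psi @` [set u | 0 < u.2])
    & (range psi `&` ~` (U `|` L) = psi @` [set u | u.2 < 0])].
  move=> Dz Lz; have [psi [pc psi0 rpsi]] := exists_chart (open_nbhs_nbhs (conj openD Dz)).
  have foot x : L (psi (x, 0)).
    by apply: (leaf_trans l1 Lz); rewrite -psi0; exact: (chart_leaf1 pc).
  have up x y : 0 < y -> U (psi (x, y)).
    by move=> y0; apply: (abU _ _ (foot x)); exact: (pc_lt2 pc x y0).
  have dn x y : y < 0 -> ~ (U `|` L) (psi (x, y)).
    by move=> y0; apply: (beU _ _ (foot x)); exact: (pc_lt2 pc x y0).
  exists psi; split=> //; apply/seteqP; split.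
  - move=> _ [[[x y] _ <-] Uxy]; exists (x, y) => //=.
    have [//|y0|y0] := ltgtP 0 y; first by case: (dn x y y0); left.
    by move: Uxy; rewrite -y0 => /(LU _ (foot x)).
  - by move=> _ [[x y] /= y0 <-]; split; [exists (x, y)|exact: up].
  - move=> _ [[[x y] _ <-] nUL]; exists (x, y) => //=.
    have [//|y0|y0] := ltgtP y 0; first by case: nUL; left; exact: up.
    by case: nUL; right; rewrite y0; exact: foot.
  - by move=> _ [[x y] /= y0 <-]; split; [exists (x, y)|exact: dn].
have cimg (psi : R * R -> P) (H : set R) : product_chart lt1 lt2 psi -> connected H ->
    connected (psi @` [set u | H u.2]).
  move=> pc cH; apply: connected_continuous_connected.
    have -> : [set u | H u.2] = [set: R] `*` H by apply/seteqP; split=> -[x y] //= [].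
    by apply: connectedX cH; apply/connected_intervalP => ? *.
  by apply: continuous_subspaceT; exact: (pc_continuous pc).
have closureE (psi : R * R -> P) z (H : set R) : product_chart lt1 lt2 psi -> psi 0 = z ->
    (forall e, 0 < e -> exists2 y, H y & `|y| < e) -> closure (psi @` [set u | H u.2]) z.
  move=> pc psi0 He V Vz.
  have : nbhs (0 : R * R) (psi @^-1` V) by apply: (pc_continuous pc); rewrite psi0.
  move=> /near_box[e e0 eV]; have [y Hy ye] := He e e0.
  exists (psi (0, y)); split; first by exists (0, y).
  by apply: eV; move: ye; rewrite ltr_norml; split => /=; lra.
have posH : connected [set y : R | 0 < y].
  by apply/connected_intervalP => x y /= x0 y0 z /andP[xz _]; exact: lt_le_trans xz.
have negH : connected [set y : R | y < 0].
  by apply/connected_intervalP => x y /= x0 y0 z /andP[_ zy]; exact: le_lt_trans y0.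
split; apply: (connected_cut cD cDl) => //; try by [apply: openI|move=> ? []].
- by move=> z [_ /LU nU] [].
- move=> p Dp nDUp nDLp; have : ~ (U `|` L) p.
    by move=> [Up|Lp]; [apply: nDUp|apply: nDLp].
  move=> /(conj oD)/open_nbhs_nbhs; apply: filterS => q nq [_ Uq].
  by apply: nq; left.
- move=> z [Dz Lz]; have [psi [pc psi0 rpsi rU rD]] := chartE z Dz Lz.
  have rDE : range psi `&` (D `&` U) = psi @` [set u | 0 < u.2].
    by rewrite setIA (setIidl rpsi).
  exists (range psi); rewrite rDE; split; [exact: open_range_chart pc|by exists 0| |].
    exact: (cimg psi [set y | 0 < y]).
  apply: (@closure_subset _ (psi @` [set u | 0 < u.2])).
    by rewrite -rDE => ? [].
  apply: (closureE psi z [set y | 0 < y]) => // e e0.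
  by exists (e / 2) => /=; rewrite ?gtr0_norm; lra.
- by move=> z [_ Lz] [_ []]; right.
- move=> p Dp nDUp nDLp; have Up : U p.
    by apply: contrapT => nUp; apply: nDUp; split=> // -[//|Lp]; apply: nDLp.
  move/(conj oU)/open_nbhs_nbhs: Up; apply: filterS => q Uq [_].
  by apply; left.
- move=> z [Dz Lz]; have [psi [pc psi0 rpsi rU rD]] := chartE z Dz Lz.
  have rDE : range psi `&` (D `&` ~` (U `|` L)) = psi @` [set u | u.2 < 0].
    by rewrite setIA (setIidl rpsi).
  exists (range psi); rewrite rDE; split; [exact: open_range_chart pc|by exists 0| |].
    exact: (cimg psi [set y | y < 0]).
  apply: (@closure_subset _ (psi @` [set u | u.2 < 0])).
    by rewrite -rDE => ? [].
  apply: (closureE psi z [set y | y < 0]) => // e e0.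
  by exists (- (e / 2)) => /=; rewrite ?normrN ?gtr0_norm; lra.
Qed.

Lemma connected_plane : connected [set: P].
Proof. exact: connected_homeomorphic (bf_plane B). Qed.

Lemma connected_side l U : is_side lt1 lt2 l U ->
  connected U /\ connected (~` (U `|` leaf lt1 l)).
Proof.
move=> sU; have := side_cut sU openT connected_plane; rewrite !setTI; apply.
  exact: connected_leaf.
by exists l; exact: leaf_refl.
Qed.

(** [U] is connected and misses the leaf, so it cannot leave [U'], with which it shares the points
    directly above [l]. *)
Lemma side_uniq l U U' : is_side lt1 lt2 l U -> is_side lt1 lt2 l U' -> U `<=` U'.
Proof.
move=> sU [oU' oD' LU' abU' beU']; have [cU _] := connected_side sU.
case: sU => [oU oD LU abU beU].
have [q lq] := exists_gt l2 l.
have Uq : U q by apply: abU lq; exact: leaf_refl.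
have U'q : U' q by apply: abU' lq; exact: leaf_refl.
move=> r Ur; apply: (@connected_near _ U U' cU _ q r) => // p Up.
have [U'p|nU'p] := pselect (U' p).
  by move/(conj oU')/open_nbhs_nbhs: (U'p); apply: filterS.
have : (~` (U' `|` leaf lt1 l)) p by case=> // /LU.
move/(conj oD')/open_nbhs_nbhs; apply: filterS => s ns _.
by split=> // U's; case: ns; left.
Qed.

Lemma aboveP l : is_side lt1 lt2 l (above lt1 lt2 l).
Proof.
have [U sU] := exists_side B l.
suff -> : above lt1 lt2 l = U by [].
apply/seteqP; split=> [q [V sV Vq]|q Uq]; last by exists U.
exact: (side_uniq sV sU).
Qed.

Local Notation L := (leaf lt1).
Local Notation A := (above lt1 lt2).
Local Notation D := (below lt1 lt2).

Lemma open_above l : open (A l). Proof. by case: (aboveP l). Qed.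

Lemma open_below l : open (D l). Proof. by case: (aboveP l). Qed.

Lemma above_leafF l q : L l q -> ~ A l q. Proof. by case: (aboveP l) => _ _ + _ _; apply. Qed.

Lemma below_leafF l q : L l q -> ~ D l q. Proof. by move=> Lq; apply; right. Qed.

Lemma above_belowF l q : A l q -> ~ D l q. Proof. by move=> Aq; apply; left. Qed.

Lemma side_cases l q : [\/ L l q, A l q | D l q].
Proof.
have [?|?] := pselect (L l q); first by constructor 1.
have [?|?] := pselect (A l q); first by constructor 2.
by constructor 3 => -[].
Qed.

Lemma above_gt l q r : L l q -> lt2 q r -> A l r.
Proof. by case: (aboveP l) => _ _ _ + _; apply. Qed.

Lemma below_lt l q r : L l q -> lt2 r q -> D l r.
Proof. by case: (aboveP l) => _ _ _ _; apply. Qed.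

Lemma above_eq l l' : L l l' -> A l = A l'.
Proof.
by move=> ll'; rewrite /above /is_side (leaf_eq l1 ll').
Qed.

Lemma below_eq l l' : L l l' -> D l = D l'.
Proof. by move=> ll'; rewrite /below (above_eq ll') (leaf_eq l1 ll'). Qed.

Lemma connected_above l : connected (A l). Proof. by have [] := connected_side (aboveP l). Qed.

Lemma connected_below l : connected (D l). Proof. by have [] := connected_side (aboveP l). Qed.

Lemma above_connected K l q r : connected K -> (forall s, K s -> ~ L l s) ->
  K q -> K r -> A l q -> A l r.
Proof.
move=> cK KL Kq Kr; apply: (@connected_near _ K (A l) cK _ q r) => // p Kp.
have [/(KL p Kp)//|Ap|Dp] := side_cases l p.
  by move/(conj (open_above l))/open_nbhs_nbhs: (Ap); apply: filterS.
move/(conj (open_below l))/open_nbhs_nbhs: (Dp); apply: filterS => s Ds _.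
by split=> As; exfalso; [exact: above_belowF As Ds|exact: above_belowF As Dp].
Qed.

Lemma below_connected K l q r : connected K -> (forall s, K s -> ~ L l s) ->
  K q -> K r -> D l q -> D l r.
Proof.
move=> cK KL Kq Kr Dq; have [/(KL r Kr)//|Ar|//] := side_cases l r.
have Aq := above_connected cK KL Kr Kq Ar.
by have := above_belowF Aq Dq.
Qed.

Lemma leaf_disjoint l q r : ~ L l q -> L q r -> ~ L l r.
Proof. by move=> nlq qr lr; apply: nlq; apply: (leaf_trans l1 lr); exact: leaf_sym. Qed.

Lemma above_leaf l q r : L q r -> A l q -> A l r.
Proof.
move=> qr Aq; apply: (above_connected (connected_leaf l1 q) _ (leaf_refl q) qr Aq).
by move=> s; apply: leaf_disjoint => /above_leafF.
Qed.

Lemma below_leaf l q r : L q r -> D l q -> D l r.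
Proof.
move=> qr Dq; apply: (below_connected (connected_leaf l1 q) _ (leaf_refl q) qr Dq).
by move=> s; apply: leaf_disjoint => /below_leafF.
Qed.

Lemma above_mono l q r : lt2 q r -> A l q -> A l r.
Proof.
move=> qr Aq; have [[m Lm qm]|nm] := pselect (exists2 m, L l m & leaf lt2 q m).
  have [mr|] : leaf lt2 r m by exact: (leaf_total l2 (leaf_lt qr) qm).
    have Lr : L l r by rewrite -mr.
    by have := above_belowF Aq (below_lt Lr qr).
  move=> [rm|mr]; last exact: (above_gt Lm mr).
  by have := above_belowF Aq (below_lt Lm (lto_trans l2 qr rm)).
apply: (above_connected (connected_leaf l2 q) _ (leaf_refl q) (leaf_lt qr) Aq).
by move=> s qs Ls; apply: nm; exists s.
Qed.

Lemma below_mono l q r : lt2 q r -> D l r -> D l q.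
Proof.
move=> qr Dr; have [Lq|Aq|//] := side_cases l q.
  by have := above_belowF (above_gt Lq qr) Dr.
by have := above_belowF (above_mono qr Aq) Dr.
Qed.

Lemma above_refl q r : lt2 q r -> A q r.
Proof. exact: above_gt (leaf_refl q). Qed.

Lemma below_refl q r : lt2 q r -> D r q.
Proof. exact: below_lt (leaf_refl r). Qed.

(** The complement is the lower side with the leaf added, hence lies between the lower side and its
    closure. *)
Lemma connected_not_above l : connected (~` A l).
Proof.
apply: (connected_between (@connected_below l)) => [q Dq Aq|q nAq V Vq].
  exact: above_belowF Aq Dq.
have [Lq|//|Dq] := side_cases l q; last by exists q; split=> //; exact: nbhs_singleton.
have [psi [pc psi0 rpsi]] := exists_chart Vq.
exists (psi (0, -1)); split; last by apply: rpsi; exists (0, -1).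
by apply: below_lt Lq _; rewrite -psi0; apply: (pc_lt2 pc); rewrite ltrN10.
Qed.

Lemma connected_not_below l : connected (~` D l).
Proof.
apply: (connected_between (@connected_above l)) => [q Aq Dq|q nDq V Vq].
  exact: above_belowF Aq Dq.
have [Lq|Aq|//] := side_cases l q; last by exists q; split=> //; exact: nbhs_singleton.
have [psi [pc psi0 rpsi]] := exists_chart Vq.
exists (psi (0, 1)); split; last by apply: rpsi; exists (0, 1).
by apply: above_gt Lq _; rewrite -psi0; apply: (pc_lt2 pc); rewrite ltr01.
Qed.

(** The complement of [D q] is connected, contains [q], and avoids the leaf of [p], which lies
    entirely in [D q]. *)
Lemma not_below_sub p q : A p q -> D q p -> ~` D q `<=` A p.
Proof.
move=> Apq Dqp r nDr.
apply: (above_connected (@connected_not_below q) _ _ nDr Apq).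
  by move=> s + ps; apply; exact: below_leaf Dqp.
exact: below_leafF (leaf_refl q).
Qed.

Lemma connected_cut_above l X : open X -> connected X -> connected (X `&` L l) ->
  X `&` L l !=set0 -> connected (X `&` A l).
Proof. by move=> oX cX cXl Xl; have [] := side_cut (aboveP l) oX cX cXl Xl. Qed.

Lemma connected_cut_below l X : open X -> connected X -> connected (X `&` L l) ->
  X `&` L l !=set0 -> connected (X `&` D l).
Proof. by move=> oX cX cXl Xl; have [] := side_cut (aboveP l) oX cX cXl Xl. Qed.

(** In a chart any point is reached from the centre by a horizontal and then a vertical move, so [E]
    is locally constant. This is the induction by which identities between heights are proved. *)
Lemma leaf_moves X (E : set P) : open X -> connected X ->
    (forall a b, X a -> X b -> L a b -> E a -> E b) ->
    (forall a b, X a -> X b -> lt2 a b -> (E a <-> E b)) ->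
  forall p q, X p -> X q -> E p -> E q.
Proof.
move=> oX cX E1 E2; apply: (connected_near cX) => p Xp.
have [psi [pc psi0 rpsi]] := exists_chart (open_nbhs_nbhs (conj oX Xp)).
have : \forall q \near p, range psi q.
  by apply: open_nbhs_nbhs; split; [exact: open_range_chart pc|exists 0].
apply: filterS => _ [[x y] _ <-] _.
have X_ u : X (psi u) by apply: rpsi; exists u.
have E1' u v : L (psi u) (psi v) -> (E (psi u) <-> E (psi v)).
  by move=> uv; split; apply: E1 => //; exact: leaf_sym.
rewrite -psi0 (E1' 0 (x, 0)); last exact: (chart_leaf1 pc).
have [y0|y0|<-//] := ltgtP 0 y; [symmetry|]; apply: E2 => //; exact: (pc_lt2 pc).
Qed.

End SideTheory.
Arguments connected_above {R P lt1 lt2} B l.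
Arguments connected_below {R P lt1 lt2} B l.
Arguments connected_not_above {R P lt1 lt2} B l.
Arguments connected_not_below {R P lt1 lt2} B l.

(** * Heights *)

Section Height.
Variables (R : realType) (P : topologicalType).

(* For [lt2 p q], the region to the right of the arc from [p] to [q] that lies
   between the leaves through [p] and [q].  The end of the leaf of [q] is
   included in the region, that of [p] is not. *)
Definition swept lt1 lt2 (p q : P) : set P :=
  above lt1 lt2 p `&` ~` above lt1 lt2 q `&` above lt2 lt1 p.

(* Leaves cross each other at most once, and in the positive direction, so a
   leaf meets the region iff its positive end is there. *)
Definition sweep lt1 lt2 (l p q : P) : int :=
  if `[< leaf lt1 l `&` swept lt1 lt2 p q !=set0 >] then 1 else 0.

(** A swept region contains its final leaf and not its initial one, so the jump at [l] has already
    happened on [l] itself. With the value -1 there, the height is 0 just below [l] and -1 just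
    above, as floors of small nonzero differences are. *)
Definition is_height lt1 lt2 (l : P) (n : P -> int) :=
  [/\ n l = -1, forall p q, leaf lt1 p q -> n p = n q
    & forall p q, lt2 p q -> n q = n p - sweep lt1 lt2 l p q].

(** Selected through its value: by [height_uniq] there is one candidate, so the result is
    canonical. *)
Definition height lt1 lt2 (l p : P) : int :=
  xget 0 [set k | exists2 n, is_height lt1 lt2 l n & n p = k].

Variables lt1 lt2 : P -> P -> Prop.
Hypothesis B : bifoliated R lt1 lt2.
Let B' := bifoliated_swap B.
Let l1 := bf_line1 B.
Let l2 := bf_line2 B.

Local Notation L := (leaf lt1).
Local Notation A := (above lt1 lt2).
Local Notation D := (below lt1 lt2).
Local Notation N := (leaf lt2).
Local Notation Rt := (above lt2 lt1).
Local Notation Lf := (below lt2 lt1).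
Local Notation T := (swept lt1 lt2).
Local Notation J := (sweep lt1 lt2).

Lemma sweep1 l p q z : L l z -> T p q z -> J l p q = 1.
Proof. by move=> Lz Sz; rewrite /sweep; case: asboolP => // -[]; exists z. Qed.

Lemma sweep0 l p q : (forall z, L l z -> ~ T p q z) -> J l p q = 0.
Proof. by move=> nS; rewrite /sweep; case: asboolP => // -[z [/nS]]. Qed.

Lemma sweepP l p q : (exists2 z, L l z & T p q z) /\ J l p q = 1 \/
  (forall z, L l z -> ~ T p q z) /\ J l p q = 0.
Proof.
have [[z Lz Sz]|nS] := pselect (exists2 z, L l z & T p q z).
  by left; split; [exists z|exact: sweep1 Lz Sz].
by right; split=> [z Lz Sz|]; [|apply: sweep0 => z Lz Sz]; apply: nS; exists z.
Qed.

Lemma above_sub p q : lt2 p q -> A q `<=` A p.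
Proof.
move=> pq r Ar; apply: (not_below_sub B (above_refl B pq) (below_refl B pq)).
exact: above_belowF.
Qed.

Lemma right_sub p q : lt1 p q -> Rt q `<=` Rt p.
Proof.
move=> pq r Ar; apply: (not_below_sub B' (above_refl B' pq) (below_refl B' pq)).
exact: above_belowF.
Qed.

Lemma sweep_same l p q : A p `<=` A q -> J l p q = 0.
Proof. by move=> pq; apply: sweep0 => z _ [[/pq]]. Qed.

(** The leaf of [m] divides the region of [p] and [q] into the two smaller ones. A leaf cannot meet
    both, since the upper side of [m] is a union of leaves. *)
Lemma sweep_add l p m q : lt2 p m -> lt2 m q ->
  J l p q = J l p m + J l m q.
Proof.
move=> pm mq; have RtE : Rt m = Rt p by apply: (above_eq B'); apply: leaf_gt.
have Apq := above_sub pm; have Amq := above_sub mq.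
case: (sweepP l p m) => -[].
  move=> [z Lz [[Apz nAmz] Rz]] ->; case: (sweepP l m q) => -[].
    move=> [z' Lz' [[Amz' nAqz'] Rz']] _; exfalso; apply: nAmz.
    by apply: (above_leaf B) Amz'; exact: (leaf_total l1 Lz' Lz).
  move=> _ ->; rewrite addr0; apply: (sweep1 Lz); split=> //; split=> //.
  by move=> /Amq.
move=> nSz ->; rewrite add0r.
case: (sweepP l m q) => -[].
  move=> [z Lz [[Amz nAqz] Rz]] ->; apply: sweep1 Lz _.
  by rewrite RtE in Rz; split=> //; split=> //; exact: Apq.
move=> nSz' ->; apply: sweep0 => z Lz [[Apz nAqz] Rz].
have [Amz|nAmz] := pselect (A m z); last by apply: (nSz z).
by apply: (nSz' z) => //; rewrite /swept RtE.
Qed.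

Lemma right_leaf a z : L a z -> (Rt a z <-> lt1 a z).
Proof.
move=> az; split=> [Rz|]; last exact: (above_refl B').
case: az Rz => [->|[//|za]] Rz; first by case: (above_leafF B' (leaf_refl a) Rz).
by have := above_belowF Rz (below_refl B' za).
Qed.

Lemma left_leaf a z : L a z -> (Lf a z <-> lt1 z a).
Proof.
move=> az; split=> [Lz|]; last exact: (below_refl B').
case: az Lz => [->|[az|//]] Lz; first by case: (below_leafF (leaf_refl a) Lz).
by have := above_belowF (above_refl B' az) Lz.
Qed.

Section ChartSweep.
Variables (psi : R * R -> P) (pc : product_chart lt1 lt2 psi).

Let psi1 x x' y : x < x' -> lt1 (psi (x, y)) (psi (x', y)).
Proof. exact: (pc_lt1 pc). Qed.

Let psi2 x y y' : y < y' -> lt2 (psi (x, y)) (psi (x, y')).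
Proof. exact: (pc_lt2 pc). Qed.

Let psiL x x' y : L (psi (x, y)) (psi (x', y)).
Proof. exact: (chart_leaf1 pc). Qed.

Let psiN x y y' : N (psi (x, y)) (psi (x, y')).
Proof. exact: (chart_leaf2 pc). Qed.

(* The region bounded by the four leaves is connected, and the chart rectangle
   is open and closed in it. *)
Lemma chart_region x x' y y' : x < x' -> y < y' ->
  Rt (psi (x, y)) `&` Lf (psi (x', y)) `&` A (psi (x, y)) `&` D (psi (x, y')) `<=`
  psi @` [set u | x < u.1 < x' /\ y < u.2 < y'].
Proof.
move=> xx' yy'; set a := psi (x, y); set b := psi (x', y).
set a' := psi (x, y'); set b' := psi (x', y'); set Q := psi @` _.
have ab : lt1 a b by exact: psi1.
have a'b' : lt1 a' b' by exact: psi1.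
have aa' : lt2 a a' by exact: psi2.
have RtE : Rt a' = Rt a by apply: (above_eq B'); exact: psiN.
have LfE : Lf b' = Lf b by apply: (below_eq B'); exact: psiN.
have cRL : connected (Rt a `&` Lf b).
  apply: (connected_cut_below B' (open_above B' a) (connected_above B' a)).
    rewrite (_ : Rt a `&` N b = N b); first exact: (connected_leaf l2).
    apply/setIidr => z bz.
    exact: (above_leaf B' bz (above_refl B' ab)).
  by exists b; split; [exact: (above_refl B' ab)|exact: leaf_refl].
have oRL : open (Rt a `&` Lf b) by apply: openI; [exact: (open_above B')|exact: (open_below B')].
have seg c d : lt1 c d -> Rt c = Rt a -> Lf d = Lf b ->
    [/\ Rt a `&` Lf b `&` L c = [set z | lt1 c z /\ lt1 z d],
        connected (Rt a `&` Lf b `&` L c) & Rt a `&` Lf b `&` L c !=set0].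
  move=> cd Rc Ld; have cE : Rt a `&` Lf b `&` L c = [set z | lt1 c z /\ lt1 z d].
    apply/seteqP; split=> z.
      rewrite -Rc -Ld => -[[Rz Lz] cz]; split; first exact: ((right_leaf cz).1 Rz).
      have dz : L d z by exact: (leaf_total l1 (leaf_lt cd)).
      exact: ((left_leaf dz).1 Lz).
    move=> [cz zd]; have Lcz := leaf_lt cz; split=> //; rewrite -Rc -Ld.
    by split; [exact: (above_refl B')|exact: (below_refl B')].
  split=> //; rewrite cE; first by apply: (connected_lt_itv l1); exact: leaf_lt.
  by have [z cz zd] := exists_between l1 cd; exists z.
have [_ ca na] := seg a b ab erefl erefl.
have cRLA := connected_cut_above B oRL cRL ca na.
have oRLA : open (Rt a `&` Lf b `&` A a) by apply: openI => //; exact: (open_above B).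
have cReg : connected (Rt a `&` Lf b `&` A a `&` D a').
  have [_ ca' na'] := seg a' b' a'b' RtE LfE.
  have AL : Rt a `&` Lf b `&` A a `&` L a' = Rt a `&` Lf b `&` L a'.
    apply/seteqP; split=> z [[]]; first by move=> [Rz Lz] _ a'z.
    move=> Rz Lz a'z; split=> //; split=> //.
    exact: (above_leaf B a'z (above_refl B aa')).
  by apply: (connected_cut_below B oRLA cRLA); rewrite AL.
have inReg u v : x < u < x' -> y < v < y' ->
    (Rt a `&` Lf b `&` A a `&` D a') (psi (u, v)).
  move=> /andP[xu ux'] /andP[yv vy']; split; first split; first split.
  - by apply: (above_gt B' (psiN x y v)); exact: psi1.
  - by apply: (below_lt B' (psiN x' y v)); exact: psi1.
  - by apply: (above_gt B (psiL x u y)); exact: psi2.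
  - by apply: (below_lt B (psiL x u y')); exact: psi2.
(* Compact in a Hausdorff plane, hence closed. Its edges lie on the four bounding leaves, so inside
   the region it coincides with the open rectangle [Q]. *)
pose K := psi @` (`[x, x'] `*` `[y, y']).
have cK : closed K.
  apply: compact_closed; first exact: (hausdorff_homeomorphic (bf_plane B)).
  apply: continuous_compact; first by apply: continuous_subspaceT; exact: (pc_continuous pc).
  by apply: compact_setX; exact: segment_compact.
have KQ z : (Rt a `&` Lf b `&` A a `&` D a') z -> K z -> Q z.
  move=> [[[Rz Lz] Az] Dz] [[u v] [/=]]; rewrite !in_itv /=.
  move=> /andP[xu ux'] /andP[yv vy'] uvz; exists (u, v) => //=; move: Rz Lz Az Dz; rewrite -uvz.
  move=> Rz Lz Az Dz; split; apply/andP; split; rewrite lt_neqAle ?xu ?ux' ?yv ?vy' andbT; apply/eqP => E.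
  - by subst u; exact: (above_leafF B' (psiN x y v) Rz).
  - by subst u; exact: (below_leafF (psiN x' y v) Lz).
  - by subst v; exact: (above_leafF B (psiL x u y) Az).
  - by subst v; exact: (below_leafF (psiL x u y') Dz).
have QK z : Q z -> K z.
  move=> [[u v] /= [/andP[? ?] /andP[? ?]] <-]; exists (u, v) => //; split.
    by rewrite /= in_itv /= !ltW.
  by rewrite /= in_itv /= !ltW.
have oQ : open Q by have := pc_open pc (@open_box _ x x' y y').
have mid c d : c < d :> R -> c < (c + d) / 2 < d by move=> ?; lra.
have mx := mid _ _ xx'; have my := mid _ _ yy'.
move=> q Rq; apply: (@connected_near _ _ Q cReg _ (psi ((x + x') / 2, (y + y') / 2)) q) => //.
- move=> p Rp; have [Qp|nQp] := pselect (Q p).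
    by apply: filterS (open_nbhs_nbhs (conj oQ Qp)).
  have oK : open (~` K) by rewrite openC.
  have nKp : (~` K) p by move=> /(KQ p Rp).
  apply: filterS (open_nbhs_nbhs (conj oK nKp)) => r nKr _.
  by split=> // /QK.
- exact: inReg.
- by exists ((x + x') / 2, (y + y') / 2).
Qed.

(** What the left edge sweeps beyond the right edge is the rectangle and pieces of the leaves
    bounding it. A leaf found there continues in the chart, or along itself, to the right of the
    right edge. *)
Let sweep_x_le l x x' y y' : x < x' -> y < y' ->
  J l (psi (x, y)) (psi (x, y')) = J l (psi (x', y)) (psi (x', y')).
Proof.
move=> xx' yy'.
have ab : lt1 (psi (x, y)) (psi (x', y)) by exact: psi1.
have a'b' : lt1 (psi (x, y')) (psi (x', y')) by exact: psi1.
have AE : A (psi (x, y)) = A (psi (x', y)) by apply: (above_eq B); exact: psiL.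
have AE' : A (psi (x, y')) = A (psi (x', y')) by apply: (above_eq B); exact: psiL.
have RR := right_sub ab.
case: (sweepP l (psi (x', y)) (psi (x', y'))) => -[].
  move=> [z Lz [[Az nAz] Rz]] ->; apply: (sweep1 Lz); split; last exact: RR.
  by rewrite AE AE'.
move=> nS ->; apply: sweep0 => z Lz [[Az nAz] Rz].
have RtE v : Rt (psi (x', y)) = Rt (psi (x', v)) by apply: (above_eq B'); exact: psiN.
pose r v := psi (x' + 1, v).
have Rr v : Rt (psi (x', y)) (r v).
  by rewrite (RtE v); apply: (above_refl B'); apply: psi1; rewrite ltrDl.
have right_end w : L z w -> Rt (psi (x', y)) w -> False.
  move=> zw Rw; apply: (nS w); first exact: (leaf_trans l1 Lz zw).
  rewrite /swept -AE -AE'; split=> //; split; first exact: (above_leaf B zw).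
  by move=> Aw; apply: nAz; apply: (above_leaf B _ Aw); exact: leaf_sym.
have [a'z|//|Dz] := side_cases lt1 lt2 (psi (x, y')) z.
  apply: (right_end (r y')) => //.
  exact: (leaf_total l1 a'z (psiL _ _ _)).
have [bz|Rbz|Lbz] := side_cases lt2 lt1 (psi (x', y)) z.
- have [w zw] := exists_gt l1 z; apply: (right_end w); first exact: leaf_lt.
  exact: (above_gt B' bz zw).
- exact: (right_end z (leaf_refl z)).
have [[u v] /= _ uvz] := chart_region xx' yy' (conj (conj (conj Rz Lbz) Az) Dz).
by apply: (right_end (r v)) => //; rewrite -uvz; exact: psiL.
Qed.

Lemma chart_sweep_x l x x' y y' : y < y' ->
  J l (psi (x, y)) (psi (x, y')) = J l (psi (x', y)) (psi (x', y')).
Proof.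
by move=> yy'; have [xx'|x'x|->//] := ltgtP x x'; [|symmetry]; exact: sweep_x_le.
Qed.

(** In a chart the sweep numbers depend only on the second coordinates and add up along a vertical
    line. Antisymmetrised, they are additive whatever the relative position of the three points. *)
Lemma chart_cocycle l u v w :
  (J l (psi v) (psi u) - J l (psi u) (psi v)) +
  (J l (psi w) (psi v) - J l (psi v) (psi w)) =
  J l (psi w) (psi u) - J l (psi u) (psi w).
Proof.
pose F s t := J l (psi (0, s)) (psi (0, t)).
have F0 s t : t <= s -> F s t = 0.
  rewrite le_eqVlt => /orP[/eqP <-|ts]; first exact: sweep_same.
  by apply: sweep_same; apply: above_sub; exact: psi2.
have Fadd s t r : s <= t -> t <= r -> F s r = F s t + F t r.
  rewrite le_eqVlt => /orP[/eqP <-|st]; first by rewrite (F0 s s) ?add0r.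
  rewrite le_eqVlt => /orP[/eqP <-|tr]; first by rewrite (F0 t t) ?addr0.
  by apply: sweep_add; exact: psi2.
have FE a b : J l (psi a) (psi b) = F a.2 b.2.
  case: a b => [x y] [x' y'] /=; have AE : A (psi (x', y')) = A (psi (x, y')).
    by apply: (above_eq B); exact: psiL.
  have -> : J l (psi (x, y)) (psi (x', y')) = J l (psi (x, y)) (psi (x, y')).
    by rewrite /sweep /swept AE.
  have [yy'|y'y] := ltP y y'; first exact: chart_sweep_x.
  rewrite F0 //; move: y'y; rewrite le_eqVlt => /orP[/eqP ->|y'y].
    exact: sweep_same.
  by apply: sweep_same; apply: above_sub; exact: psi2.
rewrite !FE; move: u.2 v.2 w.2 => {u v w} r s t.
wlog rt : r t / r <= t.
  move=> H; have [/H//|/ltW/H] := leP r t; lia.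
have Ftr := F0 _ _ rt.
have [rs|sr] := leP r s; last first.
  have Hrs := F0 _ _ (ltW sr); have st := le_trans (ltW sr) rt; have Hts := F0 _ _ st.
  by have := Fadd _ _ _ (ltW sr) rt; lia.
have [st|ts] := leP s t.
  by have := F0 _ _ rs; have := F0 _ _ st; have := Fadd _ _ _ rs st; lia.
by have := F0 _ _ rs; have := F0 _ _ (ltW ts); have := Fadd _ _ _ rt (ltW ts); lia.
Qed.

End ChartSweep.

Lemma exists_height l : exists n, is_height lt1 lt2 l n.
Proof.
have chartP p : exists psi : R * R -> P, product_chart lt1 lt2 psi /\ psi 0 = p.
  by have [psi [? ? _]] := exists_chart B (@filterT _ (nbhs p) _); exists psi.
have [psi psiP] := choice chartP.
(* The change of height from [p] to [q] when both lie in one chart, whichever of the two is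
   higher. *)
pose c p q := J l q p - J l p q.
have cpsi p q r s : range (psi p) q -> range (psi p) r -> range (psi p) s ->
    c q r + c r s = c q s.
  by move=> [u _ <-] [v _ <-] [w _ <-]; apply: chart_cocycle; have [] := psiP p.
have open_psi p : open (range (psi p)).
  by have [/open_range_chart] := psiP p.
have psi_self p : range (psi p) p by exists 0 => //; have [] := psiP p.
have near_psi p q : range (psi p) q -> \forall r \near q, range (psi p) r.
  by move=> pq; apply: open_nbhs_nbhs.
have compat p q w : range (psi p) w -> range (psi q) w ->
    \forall v \near w, c p v - c q v = c p w - c q w.
  move=> pw qw; apply: filterS2 (near_psi _ _ pw) (near_psi _ _ qw) => v pv qv.
  have := cpsi p _ _ _ (psi_self p) pw pv.
  by have := cpsi q _ _ _ (psi_self q) qw qv; lia.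
have [g gP] := potential_homeomorphic (bf_plane B) open_psi psi_self compat.
have gc p : \forall q \near p, g q = g p + c p q.
  have := gP p p I (psi_self p); apply: filterS => q; rewrite /c subrr; lia.
have cL p q : L p q -> c p q = 0.
  by move=> pq; rewrite /c !sweep_same // (above_eq B pq).
have gL p q : L p q -> g p = g q.
  move=> pq; apply/esym.
  apply: (@connected_near _ (L p) [set r | g r = g p] (connected_leaf l1 p) _ p q) => //.
    move=> r pr; apply: filterS (gc r) => s /= -> ps.
    by rewrite cL ?addr0 //; exact: (leaf_total l1 pr ps).
  exact: leaf_refl.
(* On short arcs this is the increment [c]; [sweep_add] glues the arcs. *)
have gN p q : lt2 p q -> g q = g p - J l p q.
  move=> pq; have [gm [a [b [cgm rgm gmP pE qE]]]] := leaf_point l2 (leaf_lt pq).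
  move: pq; rewrite -pE -qE => /gmP ab.
  pose Q (a b : R) := forall u v, a < u -> u < v -> v < b ->
    g (gm v) = g (gm u) - J l (gm u) (gm v).
  suff /(_ (a - 1) (b + 1)) : forall a b, Q a b by apply; lra.
  apply: itv_ind.
  - by move=> a1 b1 a2 b2 aa bb Q1 u v au uv vb; apply: Q1 => //; lra.
  - move=> a1 b1 c1 d ac cb bd Q1 Q2 u v au uv vd.
    have [vb|bv] := ltP v b1; first exact: Q1.
    have [cu|uc] := ltP c1 u; first exact: Q2.
    have um : u < (c1 + b1) / 2 by lra.
    have mv : (c1 + b1) / 2 < v by lra.
    have -> : g (gm v) = g (gm ((c1 + b1) / 2)) - J l (gm ((c1 + b1) / 2)) (gm v).
      by apply: Q2 => //; lra.
    have -> : g (gm ((c1 + b1) / 2)) = g (gm u) - J l (gm u) (gm ((c1 + b1) / 2)).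
      by apply: Q1 => //; lra.
    rewrite (@sweep_add l (gm u) (gm ((c1 + b1) / 2)) (gm v)); try exact/gmP.
    by rewrite opprD addrA.
  - move=> t; have nearP := near_comp (cgm t) (gc (gm t)).
    have [/= e e0 eP] := (nbhs_ballP t _).1 nearP.
    exists e => // u v tu uv vt.
    rewrite [g (gm v)]eP ?[g (gm u)]eP; try by rewrite -ball_normE /= ltr_distlC; lra.
    have J0 x y : y < x -> J l (gm x) (gm y) = 0.
      by move=> yx; apply: sweep_same; apply: above_sub; exact/gmP.
    have JJ x : J l (gm x) (gm x) = 0 by exact: sweep_same.
    have Jadd x y z : x < y -> y < z -> J l (gm x) (gm z) = J l (gm x) (gm y) + J l (gm y) (gm z).
      by move=> xy yz; apply: sweep_add; exact/gmP.
    rewrite /c; have [tu'|ut|tu'] := ltgtP t u.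
    + rewrite (J0 u t) // (J0 v t) ?(lt_trans tu') // (Jadd t u v) //; lia.
    + rewrite (J0 t u) //; have [tv|vt'|tv] := ltgtP t v.
      * rewrite (J0 v t) // (Jadd u t v) //; lia.
      * rewrite (J0 t v) // (Jadd u v t) //; lia.
      * rewrite -tv JJ; lia.
    + rewrite -tu' JJ; move: uv; rewrite -tu' => tv; rewrite (J0 v t) //; lia.
exists (fun p => g p - g l - 1); split.
- by rewrite subrr.
- by move=> p q /gL ->.
- by move=> p q /gN ->; lia.
Qed.

Lemma height_uniq l n n' : is_height lt1 lt2 l n -> is_height lt1 lt2 l n' -> n =1 n'.
Proof.
move=> [nl nL nN] [n'l n'L n'N] p.
apply: (@leaf_moves _ _ _ _ B setT [set q | n q = n' q] openT (connected_plane B) _ _ l p) => //.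
- by move=> a b _ _ ab /=; rewrite (nL _ _ ab) (n'L _ _ ab).
- by move=> a b _ _ ab /=; rewrite (nN _ _ ab) (n'N _ _ ab); split; lia.
- by rewrite /= nl n'l.
Qed.

Lemma heightP l : is_height lt1 lt2 l (height lt1 lt2 l).
Proof.
have [n nP] := exists_height l.
suff -> : height lt1 lt2 l = n by [].
apply/funext => p; rewrite /height; case: xgetP => [k -> [n' n'P <-]|/(_ (n p))[]].
  exact: height_uniq n'P nP p.
by exists n.
Qed.

End Height.

(** * Comparing the heights of two leaves *)

Section HeightOrder.
Variables (R : realType) (P : topologicalType).
Variables lt1 lt2 : P -> P -> Prop.
Hypothesis B : bifoliated R lt1 lt2.
Let B' := bifoliated_swap B.
Let l1 := bf_line1 B.
Let l2 := bf_line2 B.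

Local Notation L := (leaf lt1).
Local Notation A := (above lt1 lt2).
Local Notation D := (below lt1 lt2).
Local Notation N := (leaf lt2).
Local Notation Rt := (above lt2 lt1).
Local Notation Lf := (below lt2 lt1).
Local Notation T := (swept lt1 lt2).
Local Notation J := (sweep lt1 lt2).
Local Notation n := (height lt1 lt2).

Lemma height_self l : n l l = -1. Proof. by have [] := heightP B l. Qed.

Lemma height_leaf l p q : L p q -> n l p = n l q.
Proof. by have [_ + _] := heightP B l; apply. Qed.

Lemma height_up l p q : lt2 p q -> n l q = n l p - J l p q.
Proof. by have [_ _] := heightP B l; apply. Qed.

Lemma height_eq l l' p : L l l' -> n l p = n l' p.
Proof.
move=> ll'; apply: (height_uniq B (heightP B l)).
have [nl nL nN] := heightP B l'; split=> //.
  by rewrite (nL _ _ ll').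
by move=> q r qr; rewrite (nN _ _ qr) /sweep (leaf_eq l1 ll').
Qed.

Lemma sweep_target p q : lt2 p q -> J q p q = 1.
Proof.
move=> pq; have [r qr] := exists_gt l1 q.
apply: (sweep1 (leaf_lt qr)); split; first split.
- exact: (above_leaf B (leaf_lt qr) (above_refl B pq)).
- exact: (above_leafF B (leaf_lt qr)).
- by rewrite (above_eq B' (leaf_lt pq)); exact: (above_refl B' qr).
Qed.

Lemma sweep_source p q : J p p q = 0.
Proof. by apply: sweep0 => z Lz [[/(above_leafF B Lz)]]. Qed.

Lemma height_below p q : lt2 p q -> n q p = 0.
Proof. by move=> pq; have := height_up q pq; rewrite height_self sweep_target //; lia. Qed.

Lemma height_above p q : lt2 p q -> n p q = -1.
Proof. by move=> pq; rewrite (height_up p pq) height_self sweep_source subr0. Qed.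

(* The frontier of the swept region consists of two rays and an arc. *)
Lemma swept_connected K q q' x y : connected K -> lt2 q q' ->
    (forall z, K z -> ~ (z = q \/ lt1 q z)) ->
    (forall z, K z -> ~ (z = q' \/ lt1 q' z)) ->
    (forall z, K z -> ~ (lt2 q z /\ lt2 z q')) ->
  K x -> K y -> T q q' x -> T q q' y.
Proof.
move=> cK qq' Kq Kq' Kqq' Kx Ky.
have RtE : Rt q = Rt q' by apply: (above_eq B'); exact: leaf_lt.
apply: (@connected_near _ K (T q q') cK) => // p Kp.
have open_near V : open V -> V p -> \forall r \near p, V r.
  by move=> oV Vp; apply: open_nbhs_nbhs.
have nT V : (forall r, V r -> ~ T q q' r) -> open V -> V p ->
    \forall r \near p, K r -> (T q q' r <-> T q q' p).
  move=> VT oV Vp; apply: filterS (open_near V oV Vp) => r Vr _.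
  by split=> [/(VT r Vr)|/(VT p Vp)].
have DT : D q p -> \forall r \near p, K r -> (T q q' r <-> T q q' p).
  by apply: nT; [move=> r Dr [[/above_belowF /(_ Dr)]]|exact: (open_below B)].
have AT : A q' p -> \forall r \near p, K r -> (T q q' r <-> T q q' p).
  by apply: nT; [move=> r Ar [[_ /(_ Ar)]]|exact: (open_above B)].
have LT : Lf q p -> \forall r \near p, K r -> (T q q' r <-> T q q' p).
  by apply: nT; [move=> r Lr [_ /above_belowF /(_ Lr)]|exact: (open_below B')].
have [Nqp|Rqp|] := side_cases lt2 lt1 q p; last exact: LT.
  case: Nqp => [pq|[qp|pq]]; first by case: (Kq p Kp); left.
    have [q'p|[pq'|q'p]] : N p q' by apply: (leaf_total l2 (leaf_lt qp)); exact: leaf_lt.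
    - by case: (Kq' p Kp); left.
    - by case: (Kqq' p Kp).
    - by apply: AT; exact: (above_refl B).
  by apply: DT; exact: (below_refl B).
have [Lqp|Aqp|] := side_cases lt1 lt2 q p; last exact: DT.
  case: Lqp => [pq|[qp|pq]]; [by case: (Kq p Kp); left|by case: (Kq p Kp); right|].
  by apply: LT; exact: (below_refl B').
have [Lqp|Aq'p|Dq'p] := side_cases lt1 lt2 q' p; last first.
- have oV : open (A q `&` D q' `&` Rt q).
    by do 2?apply: openI; [exact: (open_above B)|exact: (open_below B)|exact: (open_above B')].
  have VT r : (A q `&` D q' `&` Rt q) r -> T q q' r.
    by move=> [[Ar Dr] Rr]; split=> //; split=> // /above_belowF /(_ Dr).
  by apply: filterS (open_near _ oV (conj (conj Aqp Dq'p) Rqp)) => r /VT Tr _; split=> // _; apply: VT.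
- exact: AT.
- case: Lqp => [pq|[qp|pq]]; [by case: (Kq' p Kp); left|by case: (Kq' p Kp); right|].
  by have := above_belowF Rqp; rewrite /below RtE (leaf_eq l2 (leaf_lt qq')); case; exact: (below_refl B' pq).
Qed.

Lemma sweep_connected K l l' q q' : connected K -> lt2 q q' ->
    (forall z, K z -> ~ (z = q \/ lt1 q z)) ->
    (forall z, K z -> ~ (z = q' \/ lt1 q' z)) ->
    (forall z, K z -> ~ (lt2 q z /\ lt2 z q')) ->
  L l `<=` K -> L l' `<=` K -> J l q q' = J l' q q'.
Proof.
move=> cK qq' Kq Kq' Kqq' lK l'K.
have TT x y : K x -> K y -> T q q' x -> T q q' y by exact: swept_connected.
case: (sweepP lt1 lt2 l q q') => -[].
  move=> [z Lz Tz] ->; apply/esym; apply: (sweep1 (leaf_refl l')).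
  by apply: TT Tz; [apply: lK|apply: l'K; exact: leaf_refl].
move=> nT ->; apply/esym; apply: sweep0 => z Lz Tz; apply: (nT l (leaf_refl l)).
by apply: TT Tz; [apply: l'K|apply: lK; exact: leaf_refl].
Qed.

(** While [q] moves above [y], the frontiers of the swept regions stay above [y]. The rest of the
    plane is connected and contains the leaves of [y0] and [y], so these are swept together. The
    constant is read just above [y], where the height relative to [y] is -1 and the one relative to
    [y0] has not changed. *)
Lemma height_diff_above y y0 q : D y y0 -> A y q -> n y0 q - n y q = n y0 y + 1.
Proof.
move=> Dyy0 Ayq; have [y' yy'] := exists_gt l2 y.
apply: (@leaf_moves _ _ _ _ B (A y) [set q | n y0 q - n y q = n y0 y + 1]
  (open_above B y) (connected_above B y) _ _ y' q) => //=.
- by move=> a b _ _ ab; rewrite !(height_leaf _ ab).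
- move=> a b Aa Ab ab; rewrite !(height_up _ ab).
  suff -> : J y0 a b = J y a b by split; lia.
  have out c z : A y c -> L c z -> A y z by move=> + cz; exact: (above_leaf B).
  apply: (sweep_connected (connected_not_above B y)) => // z nAz.
  + by move=> [za|az]; apply: nAz; apply: (out a) => //; [left|exact: leaf_lt].
  + by move=> [za|az]; apply: nAz; apply: (out b) => //; [left|exact: leaf_lt].
  + by move=> [az _]; apply: nAz; exact: (above_mono B az).
  + by move=> Az; exact: (above_belowF Az (below_leaf B nAz Dyy0)).
  + exact: (above_leafF B nAz).
- exact: (above_refl B).
- rewrite (height_up y0 yy') (height_above yy') sweep0; first lia.
  by move=> z Lz [[Az _] _]; exact: (above_belowF Az (below_leaf B Lz Dyy0)).
Qed.

(** The same argument with the complement of [D y0]. The constant is read just below [y0], where the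
    height relative to [y0] is 0. *)
Lemma height_diff_below y y0 q : A y0 y -> D y0 q -> n y q - n y0 q = n y y0.
Proof.
move=> Ayy0 Dyq; have [y' yy'] := exists_lt l2 y0.
apply: (@leaf_moves _ _ _ _ B (D y0) [set q | n y q - n y0 q = n y y0]
  (open_below B y0) (connected_below B y0) _ _ y' q) => //=.
- by move=> a b _ _ ab; rewrite !(height_leaf _ ab).
- move=> a b Aa Ab ab; rewrite !(height_up _ ab).
  suff -> : J y a b = J y0 a b by split; lia.
  have out c z : D y0 c -> L c z -> D y0 z by move=> + cz; exact: (below_leaf B).
  apply: (sweep_connected (connected_not_below B y0)) => // z nAz.
  + by move=> [za|az]; apply: nAz; apply: (out a) => //; [left|exact: leaf_lt].
  + by move=> [za|az]; apply: nAz; apply: (out b) => //; [left|exact: leaf_lt].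
  + by move=> [_ az]; apply: nAz; exact: (below_mono B az).
  + by move=> Az; exact: (above_belowF (above_leaf B nAz Ayy0) Az).
  + exact: (below_leafF nAz).
- exact: (below_refl B).
- have := height_up y yy'; rewrite (height_below yy') sweep0; first lia.
  by move=> z Lz [[_ nAz] _]; apply: nAz; exact: (above_leaf B Lz).
Qed.

End HeightOrder.

(** * Moving the first argument of the height *)

Section Sweeping.
Variables (R : realType) (P : topologicalType).
Variables lt1 lt2 : P -> P -> Prop.
Hypothesis B : bifoliated R lt1 lt2.
Let B' := bifoliated_swap B.
Let l1 := bf_line1 B.
Let l2 := bf_line2 B.

Local Notation L := (leaf lt1).
Local Notation A := (above lt1 lt2).
Local Notation D := (below lt1 lt2).
Local Notation N := (leaf lt2).
Local Notation Rt := (above lt2 lt1).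
Local Notation Lf := (below lt2 lt1).
Local Notation T := (swept lt1 lt2).
Local Notation J := (sweep lt1 lt2).
Local Notation n := (height lt1 lt2).

Section Sliver.
Variables p q : P.
Hypothesis pq : lt2 p q.

Let Apq : A p q. Proof. exact: (above_refl B). Qed.
Let Dqp : D q p. Proof. exact: (below_refl B). Qed.

Definition strip : set P := A p `&` D q.
(** The swept region without the leaf of [q]. It is open and connected with a connected complement,
    so points can move inside it while leaves outside are swept together. *)
Definition sliver : set P := A p `&` D q `&` Rt p.

Lemma open_strip : open strip.
Proof. by apply: openI; [exact: (open_above B)|exact: (open_below B)]. Qed.

Lemma connected_strip : connected strip.
Proof.
apply: (connected_cut_below B (open_above B p) (connected_above B p)).
  rewrite (_ : _ `&` _ = L q); first exact: (connected_leaf l1).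
  by apply/setIidr => z qz; exact: (above_leaf B qz Apq).
by exists q; split=> //; exact: leaf_refl.
Qed.

Lemma stripN : strip `&` N p = [set z | lt2 p z /\ lt2 z q].
Proof.
apply/seteqP; split=> z.
  move=> [[Az Dz] [zp|[pz|zp]]].
  - by move: Az; rewrite zp => /(above_leafF B (leaf_refl p)).
  - split=> //; have [zq|[qz|//]] : N q z by apply: (leaf_total l2 (leaf_lt pq)); exact: leaf_lt.
      by move: Dz; rewrite -zq => /(below_leafF (leaf_refl z)).
    by case: (above_belowF (above_refl B qz) Dz).
  - by case: (above_belowF Az (below_refl B zp)).
move=> [pz zq]; split; last exact: leaf_lt.
by split; [exact: (above_refl B)|exact: (below_refl B)].
Qed.

Let cN : connected (strip `&` N p).
Proof. by rewrite stripN; apply: (connected_lt_itv l2); exact: leaf_lt. Qed.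

Let N0 : strip `&` N p !=set0.
Proof. by rewrite stripN; have [z ? ?] := exists_between l2 pq; exists z. Qed.

Lemma connected_sliver : connected sliver.
Proof. exact: (connected_cut_above B' open_strip connected_strip). Qed.

Lemma connected_left_sliver : connected (strip `&` Lf p).
Proof. exact: (connected_cut_below B' open_strip connected_strip). Qed.

Lemma open_sliver : open sliver.
Proof. by apply: openI; [exact: open_strip|exact: (open_above B')]. Qed.

Lemma connected_not_sliver : connected (~` sliver).
Proof.
have -> : ~` sliver = (~` Rt p `|` ~` A p) `|` ~` D q.
  by rewrite /sliver !setCI setUC setUA.
have nRtq : ~ Rt p q by apply: (above_leafF B'); exact: leaf_lt.
apply: connectedU; last exact: (connected_not_below B).
  by exists q; split; [left|exact: (below_leafF (leaf_refl q))].
apply: connectedU; [|exact: (connected_not_above B')|exact: (connected_not_above B)].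
by exists p; split; [exact: (above_leafF B' (leaf_refl p))|exact: (above_leafF B (leaf_refl p))].
Qed.

Lemma sliver_swept l : (forall z, L l z -> ~ sliver z) -> ~ L l q ->
  forall z, L l z -> ~ T p q z.
Proof.
move=> nS nlq z Lz [[Az nAz] Rz]; apply: (nS z Lz); split=> //; split=> //.
by case=> // qz; apply: nlq; apply: (leaf_trans l1 Lz); exact: leaf_sym.
Qed.

Lemma sliver_point a : lt2 p a -> lt2 a q -> exists2 r, sliver r & lt1 a r.
Proof.
move=> pa aq; have [r ar] := exists_gt l1 a; exists r => //.
have Lar := leaf_lt ar; split; first split.
- exact: (above_leaf B Lar (above_refl B pa)).
- exact: (below_leaf B Lar (below_refl B aq)).
- by rewrite (above_eq B' (leaf_lt pa)); exact: (above_refl B').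
Qed.

Lemma sliver_ray a z : sliver a -> z = a \/ lt1 a z -> sliver z.
Proof.
move=> Sa [->//|az]; case: Sa => -[Aa Da] Ra; have Laz := leaf_lt az.
split; first by split; [exact: (above_leaf B Laz)|exact: (below_leaf B Laz)].
exact: (above_mono B' az).
Qed.

Lemma sliver_seg a b z : sliver a -> sliver b -> lt2 a z /\ lt2 z b -> sliver z.
Proof.
move=> [[Aa Da] Ra] [[Ab Db] Rb] [az zb]; split.
  by split; [exact: (above_mono B az)|exact: (below_mono B zb)].
exact: (above_leaf B' (leaf_lt az)).
Qed.

(** Moves inside the sliver have their sweep frontiers inside it, and both leaves lie in its
    connected complement. *)
Lemma height_diff_sliver l l' a b : (forall z, L l z -> ~ sliver z) ->
    (forall z, L l' z -> ~ sliver z) -> sliver a -> sliver b ->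
  n l a - n l' a = n l b - n l' b.
Proof.
move=> lS l'S Sa Sb; apply/esym.
apply: (@leaf_moves _ _ _ _ B sliver [set b | n l b - n l' b = n l a - n l' a]
  open_sliver connected_sliver _ _ a b) => //=.
- by move=> c d _ _ cd; rewrite !(height_leaf B _ cd).
- move=> c d Sc Sd cd; rewrite !(height_up B _ cd).
  suff -> : J l c d = J l' c d by split; lia.
  apply: (sweep_connected B connected_not_sliver) => // z nSz zc; apply: nSz.
  + exact: (sliver_ray Sc).
  + exact: (sliver_ray Sd).
  + exact: (sliver_seg Sc Sd).
Qed.

Lemma leaf_not_sliver z : L p z \/ L q z -> ~ sliver z.
Proof.
by move=> [pz [[/(above_leafF B pz)]]|qz [[_ /(below_leafF qz)]]].
Qed.

(** The difference is constant on the sliver and is read at [r], on a leaf that crosses the arc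
    strictly between [p] and [q]: it is below [q], with height 0, and above [p], with height -1. *)
Lemma height_diff_on_sliver x : sliver x -> n q x - n p x = 1.
Proof.
move=> Sx; have [m pm mq] := exists_between l2 pq.
have [r Sr mr] := sliver_point pm mq.
rewrite (@height_diff_sliver q p x r) //; try by move=> z Lz; apply: leaf_not_sliver; tauto.
rewrite -!(height_leaf B _ (leaf_lt mr)) (height_below B mq) (height_above B pm); lia.
Qed.

(* The correction term records the leaves that pass from the left of the arc
   into the region on its right. *)
Lemma height_diff_left x : (strip `&` Lf p) x -> (forall z, L x z -> ~ N p z) ->
  n q x = n p x.
Proof.
move=> Sx xN.
pose meets a := exists2 z, L a z & N p z.
pose E := [set a | n q a - n p a = if `[< meets a >] then 1 else 0].
suff : E x by rewrite /E /=; case: asboolP => [[z Lz]|_]; [case/(xN z Lz)|lia].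
have [m pm mq] := exists_between l2 pq.
have [r rm] := exists_lt l1 m.
have Lrm := leaf_lt rm.
apply: (@leaf_moves _ _ _ _ B (strip `&` Lf p) E _ connected_left_sliver _ _ r x) => //.
- by apply: openI; [exact: open_strip|exact: (open_below B')].
- move=> a b _ _ ab; rewrite /E /= !(height_leaf B _ ab).
  by rewrite /meets (leaf_eq l1 ab).
- move=> a b [[Aa Da] La] [[Ab Db] Lb] ab.
  have NaE : Rt a = Rt b by apply: (above_eq B'); exact: leaf_lt.
  have right_meet c z : Lf p c -> L c z -> N p z -> Rt c z.
    move=> Lc [zc|[cz|zc]] pz.
    - by move: Lc; rewrite -zc => /(below_leafF pz).
    - exact: (above_refl B').
    - by have := above_belowF (above_gt B' pz zc) Lc.
  have rightN c z : Lf p c -> meets c -> N p z -> Rt c z.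
    move=> Lc [w cw pw] pz; apply: (above_leaf B' (leaf_total l2 pw pz)).
    exact: (right_meet c).
  have meetA c w : A p c -> L c w -> N p w -> D c p.
    move=> Ac cw pw; have pw' : lt2 p w.
      case: pw => [wp|[//|wp]]; have Aw := above_leaf B cw Ac.
        by case: (above_leafF B (leaf_refl p)); rewrite -{2}wp.
      by case: (above_belowF Aw (below_refl B wp)).
    by rewrite (below_eq B cw); exact: (below_refl B).
  have meetD c w : D q c -> L c w -> N p w -> A c q.
    move=> Dc cw pw; have wq : lt2 w q.
      have Dw := below_leaf B cw Dc.
      have [wq|[qw|//]] : N q w by apply: (leaf_total l2 (leaf_lt pq)).
        by move: Dw; rewrite wq => /(below_leafF (leaf_refl q)).
      by case: (above_belowF (above_refl B qw) Dw).
    by rewrite (above_eq B cw); exact: (above_refl B).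
  have nmeet_above c z : ~ meets c -> N p z -> A c z -> forall w, N p w -> A c w.
    move=> nc pz Az w pw; apply: (above_connected B (connected_leaf l2 p) _ pz pw Az).
    by move=> s ps cs; apply: nc; exists s.
  have nmeet_below c z : ~ meets c -> N p z -> D c z -> forall w, N p w -> D c w.
    move=> nc pz Az w pw; apply: (below_connected B (connected_leaf l2 p) _ pz pw Az).
    by move=> s ps cs; apply: nc; exists s.
  have Jp0 c d : D c p -> J p c d = 0.
    by move=> Dcp; apply: sweep0 => z pz [[Az _] _]; exact: (above_belowF Az (below_leaf B pz Dcp)).
  have Jq0 c d : A d q -> J q c d = 0.
    by move=> Adq; apply: sweep0 => z qz [[_ nAz] _]; apply: nAz; exact: (above_leaf B qz).
  have pp : N p p by exact: leaf_refl.
  have pqN : N p q by exact: leaf_lt.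
  rewrite /E /= !(height_up B _ ab).
  (* If both leaves cross [N p], neither [p] nor [q] is swept. If the crossing is lost from [a] to
     [b], only [q] is swept; if it is gained, only [p]. If neither crosses, the connected union of
     [L p], [N p] and [L q] avoids the frontier, so [p] and [q] are swept together or not at all. *)
  case: asboolP => [[w aw pw]|na]; case: asboolP => [[w' bw' pw']|nb].
  + rewrite (Jp0 a b) ?(Jq0 a b); [split; lia|exact: meetD bw' pw'|exact: meetA aw pw].
  + have Dap := meetA _ _ Aa aw pw; have Aaq := meetD _ _ Da aw pw.
    have Dbw : D b w by apply: (below_leaf B aw); exact: (below_refl B).
    rewrite (Jp0 a b) // (@sweep1 _ lt1 lt2 q a b q (leaf_refl q)); first by split; lia.
    split; last by apply: (rightN a) => //; exists w.
    by split=> //; move=> /above_belowF; apply; exact: (nmeet_below b w).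
  + have Dbp := meetA _ _ Ab bw' pw'; have Abq := meetD _ _ Db bw' pw'.
    have Aaw : A a w' by apply: (above_leaf B bw'); exact: (above_refl B).
    rewrite (Jq0 a b) // (@sweep1 _ lt1 lt2 p a b p (leaf_refl p)); first by split; lia.
    split; last by rewrite NaE; apply: (rightN b) => //; exists w'.
    by split; [exact: (nmeet_above a w')|move=> /above_belowF; apply].
  + suff -> : J q a b = J p a b by split; lia.
    pose K := (L p `|` N p) `|` L q.
    have cK : connected K.
      apply: connectedU; last exact: (connected_leaf l1 q).
        by exists q; split; [right|exact: leaf_refl].
      apply: connectedU; [by exists p; split; exact: leaf_refl|exact: (connected_leaf l1 p)|exact: (connected_leaf l2 p)].
    have nK c z : A p c -> D q c -> ~ meets c -> L c z -> ~ K z.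
      move=> Ac Dc nc cz [[pz|pz]|qz].
      - exact: (above_leafF B pz (above_leaf B cz Ac)).
      - by apply: nc; exists z.
      - exact: (below_leafF qz (below_leaf B cz Dc)).
    apply: (sweep_connected B cK) => //.
    * by move=> z Kz az; apply: (nK a z) => //; case: az => [->|/leaf_lt //]; exact: leaf_refl.
    * by move=> z Kz az; apply: (nK b z) => //; case: az => [->|/leaf_lt //]; exact: leaf_refl.
    * move=> z Kz [az zb]; case: Kz => [[pz|pz]|qz].
      - exact: (above_leafF B pz (above_mono B az Aa)).
      - exact: (below_leafF pz (below_leaf B' (leaf_lt az) La)).
      - exact: (below_leafF qz (below_mono B zb Db)).
    * by move=> z qz; right.
    * by move=> z pz; left; left.
- split; last exact: (below_lt B' (leaf_lt pm) rm).
  split; [apply: (above_leaf B (leaf_sym Lrm))|apply: (below_leaf B (leaf_sym Lrm))].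
    exact: (above_refl B).
  exact: (below_refl B).
- rewrite /E /= !(height_leaf B _ Lrm) (height_below B mq) (height_above B pm).
  by case: asboolP => // -[]; exists m => //; exact: leaf_lt.
Qed.

(** In the circle picture, the end of the moving base leaf passes the fixed end of [x]. If the leaf
    of [x] enters the sliver, the heights are compared there. Otherwise it lies below [p], above
    [q], or in the left part of the strip without crossing the arc. *)
Lemma height_transport x : ~ L p x -> ~ L q x -> n q x = n p x + J x p q.
Proof.
move=> npx nqx; have [[z xz Sz]|nS] := pselect (exists2 z, L x z & sliver z).
  rewrite (sweep1 xz); last first.
    by case: Sz => -[Az Dz] Rz; split=> //; split=> // /above_belowF; apply.
  by rewrite !(height_leaf B _ xz); have := height_diff_on_sliver Sz; lia.
have {}nS z : L x z -> ~ sliver z by move=> xz Sz; apply: nS; exists z.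
rewrite sweep0 ?addr0; last first.
  by apply: sliver_swept => // xq; apply: nqx; exact: leaf_sym.
have [//|Apx|Dpx] := side_cases lt1 lt2 p x; last first.
  by have := height_diff_below B Apq Dpx; rewrite (height_below B pq); lia.
have [//|Aqx|Dqx] := side_cases lt1 lt2 q x.
  by have := height_diff_above B Dqp Aqx; rewrite (height_above B pq); lia.
have xN z : L x z -> ~ N p z.
  move=> xz pz; have : (strip `&` N p) z.
    by split=> //; split; [exact: (above_leaf B xz)|exact: (below_leaf B xz)].
  rewrite stripN => -[pz' zq]; have [r Sr zr] := sliver_point pz' zq.
  by apply: (nS r) => //; apply: (leaf_trans l1 xz); exact: leaf_lt.
have [Npx|Rpx|Lpx] := side_cases lt2 lt1 p x.
- by case: (xN x (leaf_refl x)).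
- by case: (nS x (leaf_refl x)).
- exact: height_diff_left.
Qed.

End Sliver.

(* The sum is unchanged when [y] moves on one side of [x], and is known near [x]. *)
Lemma height_antisym x y : ~ L x y -> n y x + n x y = -1.
Proof.
move=> nxy; pose E := [set y | n y x + n x y = -1].
have step X z : open X -> connected X -> (forall y, X y -> ~ L x y) -> X z -> X y ->
    E z -> E y.
  move=> oX cX Xx; apply: (@leaf_moves _ _ _ _ B X E oX cX).
    by move=> a b Xa Xb ab; rewrite /E /= (height_eq B _ ab) (height_leaf B _ ab).
  (* By [height_transport], [n y x] gains the very sweep of [x] that [n x y] loses. *)
  move=> a b Xa Xb ab; rewrite /E /= (height_up B _ ab).
  rewrite (@height_transport a b ab x) => [|/leaf_sym/(Xx a Xa)//|/leaf_sym/(Xx b Xb)//].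
  by split; lia.
have [//|Axy|Dxy] := side_cases lt1 lt2 x y.
  have [z xz] := exists_gt l2 x.
  apply: (step (A x) z) => //.
  - exact: (open_above B).
  - exact: (connected_above B).
  - by move=> w Aw xw; exact: (above_leafF B xw Aw).
  - exact: (above_refl B).
  - by rewrite /E /= (height_below B xz) (height_above B xz).
have [z xz] := exists_lt l2 x.
apply: (step (D x) z) => //.
- exact: (open_below B).
- exact: (connected_below B).
- by move=> w Aw xw; exact: (below_leafF xw Aw).
- exact: (below_refl B).
- by rewrite /E /= (height_below B xz) (height_above B xz).
Qed.

Lemma sweep_le l p m q : lt2 p m -> lt2 m q -> J l p q = 0 -> J l p m = 0.
Proof.
move=> pm mq; rewrite (sweep_add B l pm mq).
by rewrite /sweep; do 2!case: asboolP.
Qed.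

(** When [x] is swept, the moving leaf has the end of [x] up to full turns, which [n x p] counts,
    and the height relative to [y] is still its value at [p]. Unless [x] is on the leaf of [q], the
    leaves of [y] and [p] are compared on the sliver: [n y x - n p x] equals [n y p + 1], and
    antisymmetry replaces [n p x] by [-1 - n x p]. *)
Lemma height_through p q x y : lt2 p q -> J x p q = 1 -> J y p q = 0 ->
  n y x = n y p - n x p.
Proof.
move=> pq Jx Jy; have [qx|nqx] := pselect (L q x).
  rewrite -(height_leaf B y qx) (height_up B y pq) Jy.
  by rewrite -(height_eq B p qx) (height_below B pq).
have [[[z xz Tz] _]|[_]] := sweepP lt1 lt2 x p q; last by rewrite Jx.
have Sz : sliver p q z.
  case: Tz => -[Az nAz] Rz; split=> //; split=> // -[//|qz].
  by apply: nqx; apply: (leaf_trans l1 qz); exact: leaf_sym.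
have yS w : L y w -> ~ sliver p q w.
  move=> yw [[Aw Dw] Rw]; have : J y p q = 1.
    by apply: (sweep1 yw); split=> //; split=> // /above_belowF; apply.
  by rewrite Jy.
have pS w : L p w -> ~ sliver p q w by move=> pw; apply: leaf_not_sliver; left.
have [m pm mq] := exists_between l2 pq.
have [r Sr mr] := sliver_point pm mq.
have := height_diff_sliver pq yS pS Sz Sr.
rewrite -!(height_leaf B _ (leaf_lt mr)) (height_above B pm) (height_up B y pm).
rewrite (sweep_le pm mq Jy) -!(height_leaf B _ xz).
have npx : ~ L x p.
  move=> xp; have : A p z by case: Sz => -[].
  by apply: (above_leafF B); exact: (leaf_total l1 xp xz).
by have := height_antisym npx; lia.
Qed.

(* By [height_through] the difference takes one value before and one value after
   a sweep over [x], and the same two values for a sweep over [y]. *)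
Lemma height_bounds x y p : ~ L x y -> n y x <= n y p - n x p <= n y x + 1.
Proof.
move=> nxy.
suff : [set p | n y x <= n y p - n x p <= n y x + 1] p by [].
apply: (@leaf_moves _ _ _ _ B setT _ openT (connected_plane B) _ _ x p) => //.
- by move=> a b _ _ ab /=; rewrite !(height_leaf B _ ab).
- move=> a b _ _ ab /=; rewrite !(height_up B _ ab).
  have H := height_antisym nxy.
  case: (sweepP lt1 lt2 x a b) => -[_ Jx]; case: (sweepP lt1 lt2 y a b) => -[_ Jy].
  + by rewrite Jx Jy; split; lia.
  + have := height_through ab Jx Jy; rewrite Jx Jy; split; lia.
  + have := height_through ab Jy Jx; rewrite Jx Jy; split; lia.
  + by rewrite Jx Jy; split; lia.
- rewrite /= (height_self B); lia.
Qed.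

End Sweeping.

(** * Orders on the plane and on the group *)

Section LeftOrder.
Variables (G : groupType) (T : eqType) (act : G -> T -> T) (lt : T -> T -> Prop).
Hypothesis actM : forall g h x, act (g * h)%g x = act g (act h x).
Hypothesis act_faithful : forall g h, act g =1 act h -> g = h.
Hypothesis lt_irr : forall x, ~ lt x x.
Hypothesis lt_trans : forall x y z, lt x y -> lt y z -> lt x z.
Hypothesis lt_total : forall x y, x <> y -> lt x y \/ lt y x.
Hypothesis act_mono : forall g x y, lt x y -> lt (act g x) (act g y).

(** Two elements are compared at the first point, for a well-ordering of [T], where they act
    differently. Multiplying both on the left by [g] keeps this point, since [act g] is injective,
    and keeps the order of the two images, since [act g] is monotone. *)
Lemma left_orderable_action : left_orderable G.
Proof.
have [W wW] := well_ordering_principle T.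
pose dif f g := [pred x | act f x != act g x].
pose ltG f g := exists2 x, minimum_of W (dif f g) x & lt (act f x) (act g x).
have difC f g x : minimum_of W (dif f g) x -> minimum_of W (dif g f) x.
  move=> [xfg xmin]; split=> [|y]; first by rewrite inE eq_sym; exact: xfg.
  by rewrite inE eq_sym => yfg; exact: xmin.
have ltG_asym f g : ltG f g -> ltG g f -> False.
  move=> [x xm fg] [y /difC ym gf].
  have nE : nonempty (dif f g) by exists x; case: xm.
  have [z [_ zU]] := wW _ nE.
  by apply: (@lt_irr (act f z)); apply: (@lt_trans _ (act g z)); [rewrite (zU x)|rewrite (zU y)].
have ltG_trans f g h : ltG f g -> ltG g h -> ltG f h.
  move=> [x xm fg] [y ym gh].
  pose E := [pred x | (x \in dif f g) || (x \in dif g h)].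
  have nE : nonempty E by exists x; rewrite inE; case: xm => ->.
  have [z [[zE zmin] _]] := wW _ nE.
  have fgz : act f z = act g z \/ lt (act f z) (act g z).
    have [->|fgz] := eqVneq (act f z) (act g z); [by left|right].
    have zm : minimum_of W (dif f g) z.
      by split=> // w wfg; apply: zmin; rewrite inE wfg.
    have nfg : nonempty (dif f g) by exists z.
    by have [w [_ wU]] := wW _ nfg; rewrite -(wU z zm) (wU x xm).
  have ghz : act g z = act h z \/ lt (act g z) (act h z).
    have [->|ghz] := eqVneq (act g z) (act h z); [by left|right].
    have zm : minimum_of W (dif g h) z.
      by split=> // w wgh; apply: zmin; rewrite inE wgh orbT.
    have ngh : nonempty (dif g h) by exists z.
    by have [w [_ wU]] := wW _ ngh; rewrite -(wU z zm) (wU y ym).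
  have fhz : lt (act f z) (act h z).
    case: fgz ghz => [fgz|fgz] [ghz|ghz]; last exact: lt_trans ghz.
    - by move: zE; rewrite !inE fgz ghz eqxx.
    - by rewrite fgz.
    - by rewrite -ghz.
  exists z => //; split; first by rewrite inE; apply/eqP => E'; rewrite E' in fhz; exact: lt_irr fhz.
  move=> w; rewrite inE => fhw; apply: zmin; rewrite !inE.
  by apply: contraNT fhw; rewrite negb_or !negbK => /andP[/eqP -> /eqP ->].
exists (fun f g => `[< f = g \/ ltG f g >]); split.
- by move=> f; apply/asboolP; left.
- move=> f g /andP[/asboolP[//|fg] /asboolP[//|gf]].
  by have := ltG_asym _ _ fg gf.
- move=> g f h /asboolP[->//|fg] /asboolP[<-|gh]; apply/asboolP; right => //.
  exact: ltG_trans gh.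
- move=> f g; have [->|/eqP fg] := eqVneq f g; first by apply/orP; left; apply/asboolP; left.
  have nfg : nonempty (dif f g).
    apply: contrapT => nE; apply: fg; apply: act_faithful => x.
    by apply: contrapT => fgx; apply: nE; exists x; rewrite inE; apply/eqP.
  have [x [xm _]] := wW _ nfg.
  have /lt_total[fgx|gfx] : act f x <> act g x by case: xm => + _; rewrite inE => /eqP.
    by apply/orP; left; apply/asboolP; right; exists x.
  by apply/orP; right; apply/asboolP; right; exists x => //; exact: difC.
- move=> g f h /asboolP[->|[x [xfh xmin] fhx]]; apply/asboolP; first by left.
  right; exists x; last by rewrite !actM; exact: act_mono.
  have inj a b : act g a = act g b -> a = b.
    move=> ab; apply: contrapT => /lt_total[/(@act_mono g)|/(@act_mono g)];
    by rewrite ab => /lt_irr.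
  split.
    by rewrite inE !actM; apply/eqP => /inj/eqP; apply/negP.
  move=> y; rewrite inE !actM => gy; apply: xmin; rewrite inE.
  by apply: contraNN gy => /eqP ->.
Qed.

End LeftOrder.

Section PointOrder.
Variables (R : realType) (P : topologicalType).
Variables lt1 lt2 : P -> P -> Prop.
Hypothesis B : bifoliated R lt1 lt2.
Let l1 := bf_line1 B.

Local Notation L := (leaf lt1).
Local Notation n := (height lt1 lt2).

Definition point_lt (p q : P) : Prop :=
  ~ L p q /\ 0 <= n q p \/ lt1 p q.

Lemma point_lt_irr p : ~ point_lt p p.
Proof. by move=> [[]|/(lto_irr l1)//]; case; exact: leaf_refl. Qed.

(** For three leaves, the lower bound of [height_bounds] makes a sum of two nonnegative heights a
    lower bound of the third. The value -1 of a height on its own leaf excludes that [p] and [r]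
    share a leaf. *)
Lemma point_lt_trans p q r : point_lt p q -> point_lt q r -> point_lt p r.
Proof.
move=> [[npq pq]|pq] [[nqr qr]|qr].
- have hr : 0 <= n r p by have := height_bounds B p nqr; lia.
  left; split=> // Lpr; have := height_leaf B r Lpr.
  by rewrite (height_self B); lia.
- have Lqr := leaf_lt qr; left; rewrite -(height_eq B p Lqr); split=> // Lpr.
  by apply: npq; apply: (leaf_trans l1 Lpr); exact: leaf_sym.
- have Lpq := leaf_lt pq; left; rewrite (height_leaf B r Lpq); split=> // Lpr.
  by apply: nqr; exact: (leaf_total l1 Lpq Lpr).
- by right; exact: (lto_trans l1 pq qr).
Qed.

(** Of two integers with sum -1 exactly one is nonnegative. *)
Lemma point_lt_total p q : p <> q -> point_lt p q \/ point_lt q p.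
Proof.
move=> pq; have [[qp|[|]]|npq] := pselect (L p q); first by case: pq.
- by left; right.
- by right; right.
- have := height_antisym B npq; have [|h] := leP 0 (n q p); first by left; left.
  by right; left; split; [move/leaf_sym|lia].
Qed.

End PointOrder.

(** * Invariance under automorphisms *)

Section Equivariance.
Variable P : topologicalType.
Implicit Types lt : P -> P -> Prop.

Definition equivariant lt (g : P -> P) := forall p q, lt (g p) (g q) <-> lt p q.

Lemma leaf_equivariant lt g p q : injective g -> equivariant lt g ->
  leaf lt (g p) (g q) <-> leaf lt p q.
Proof.
move=> gI gE; rewrite /leaf /= !gE; split=> -[qp|]; [left|by right|left|by right].
  exact: gI.
by rewrite qp.
Qed.

Lemma side_preimage lt1 lt2 (g : P -> P) l U : bijective g -> continuous g ->
    equivariant lt1 g -> equivariant lt2 g ->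
  is_side lt1 lt2 (g l) U -> is_side lt1 lt2 l (g @^-1` U).
Proof.
move=> /bij_inj gI cg g1 g2 [oU oD LU abU beU].
have LE q : leaf lt1 (g l) (g q) <-> leaf lt1 l q by exact: leaf_equivariant.
have LgE : leaf lt1 l = g @^-1` leaf lt1 (g l) by apply/seteqP; split=> q /LE.
split.
- by apply: open_comp => // ? _; exact: cg.
- by rewrite LgE -preimage_setU preimage_setC; apply: open_comp => // ? _; exact: cg.
- by move=> q /LE; exact: LU.
- by move=> q x /LE Lq /g2; exact: (abU _ _ Lq).
- by move=> q x /LE Lq /g2 xq; rewrite LgE; exact: (beU _ _ Lq xq).
Qed.

Lemma above_equivariant lt1 lt2 (g g' : P -> P) p q :
    cancel g g' -> cancel g' g -> continuous g -> continuous g' ->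
    equivariant lt1 g -> equivariant lt2 g ->
  above lt1 lt2 (g p) (g q) <-> above lt1 lt2 p q.
Proof.
move=> gK g'K cg cg' g1 g2.
have bg : bijective g by exists g'.
have bg' : bijective g' by exists g.
have g'1 : equivariant lt1 g' by move=> a b; rewrite -g1 !g'K.
have g'2 : equivariant lt2 g' by move=> a b; rewrite -g2 !g'K.
split=> -[U sU Uq].
  by exists (g @^-1` U) => //; exact: side_preimage sU.
exists (g' @^-1` U); last by rewrite /preimage /= gK.
by apply: side_preimage => //; rewrite gK.
Qed.

Lemma sweep_equivariant lt1 lt2 (g g' : P -> P) l p q :
    cancel g g' -> cancel g' g -> continuous g -> continuous g' ->
    equivariant lt1 g -> equivariant lt2 g ->
  sweep lt1 lt2 (g l) (g p) (g q) = sweep lt1 lt2 l p q.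
Proof.
move=> gK g'K cg cg' g1 g2.
have gI := can_inj gK.
have sweptE z : swept lt1 lt2 (g p) (g q) (g z) <-> swept lt1 lt2 p q z.
  have E1 a b := above_equivariant a b gK g'K cg cg' g1 g2.
  have E2 a b := above_equivariant a b gK g'K cg cg' g2 g1.
  by rewrite /swept /setI /setC /= !E1 E2.
rewrite /sweep; congr (if _ then _ else _); apply: asbool_equiv_eq; split=> -[z [Lz Sz]].
  exists (g' z); split; first by apply/(leaf_equivariant _ _ gI g1); rewrite g'K.
  by apply/sweptE; rewrite g'K.
by exists (g z); split; [exact/(leaf_equivariant _ _ gI g1)|exact/sweptE].
Qed.

End Equivariance.

(** The height of [g l] pulled back by [g] satisfies the conditions for the height of [l], so
    uniqueness identifies them. *)
Lemma height_equivariant (R : realType) (P : topologicalType)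
    (lt1 lt2 : P -> P -> Prop) (g g' : P -> P) l p : bifoliated R lt1 lt2 ->
    cancel g g' -> cancel g' g -> continuous g -> continuous g' ->
    equivariant lt1 g -> equivariant lt2 g ->
  height lt1 lt2 (g l) (g p) = height lt1 lt2 l p.
Proof.
move=> B gK g'K cg cg' g1 g2; have gI := can_inj gK.
apply: (height_uniq B (n := height lt1 lt2 (g l) \o g) _ (heightP B l)).
have [nl nL nN] := heightP B (g l); split=> //=.
  by move=> a b /(leaf_equivariant _ _ gI g1); exact: nL.
by move=> a b /g2 /nN ->; rewrite (sweep_equivariant _ _ _ gK g'K cg cg' g1 g2).
Qed.

Lemma point_lt_equivariant (R : realType) (P : topologicalType)
    (lt1 lt2 : P -> P -> Prop) (g g' : P -> P) p q : bifoliated R lt1 lt2 ->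
    cancel g g' -> cancel g' g -> continuous g -> continuous g' ->
    equivariant lt1 g -> equivariant lt2 g ->
  point_lt lt1 lt2 p q -> point_lt lt1 lt2 (g p) (g q).
Proof.
move=> B gK g'K cg cg' g1 g2; have gI := can_inj gK.
rewrite /point_lt (height_equivariant _ _ B gK g'K cg cg' g1 g2) g1.
by rewrite (leaf_equivariant _ _ gI g1).
Qed.

(** * Charts of a bifoliated plane *)

Section RealMaps.
Variable R : realType.

Definition open_map (T1 T2 : topologicalType) (f : T1 -> T2) :=
  forall V, open V -> open (f @` V).

Lemma open_map_incr (f : R -> R) : continuous f ->
  (forall x y, x < y -> f x < f y) -> open_map f.
Proof.
move=> cf f_incr V oV; rewrite openE => _ [t Vt <-]; rewrite /interior.
have [/= e e0 eV] := (nbhs_ballP t _).1 (open_nbhs_nbhs (conj oV Vt)).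
have tl : f (t - e / 2) < f t by apply: f_incr; lra.
have tr : f t < f (t + e / 2) by apply: f_incr; lra.
have fl : \forall z \near f t, f (t - e / 2) < z by exact: lt_nbhsr.
have fr : \forall z \near f t, z < f (t + e / 2) by exact: lt_nbhsl.
apply: filterS2 fl fr => z zl zr.
have le : t - e / 2 <= t + e / 2 by lra.
have [|c] := IVT le (continuous_subspaceT cf) (v := z).
  by rewrite min_l ?max_r ?(ltW zl) ?(ltW zr) // ltW // (lt_trans tl).
rewrite in_itv /= => /andP[tc ct] <-; exists c => //; apply: eV.
by rewrite -ball_normE /= ltr_distlC; lra.
Qed.

Lemma open_map_opp : open_map (fun x : R => - x).
Proof.
move=> V oV; have -> : (fun x : R => - x) @` V = (fun x => - x) @^-1` V.
  apply/seteqP; split=> x; first by move=> [y Vy <-]; rewrite /= opprK.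
  by move=> Vx; exists (- x) => //; rewrite opprK.
by apply: open_comp => // x _; exact: opp_continuous.
Qed.

Definition map_prod (s t : R -> R) (u : R * R) : R * R := (s u.1, t u.2).

Lemma map_prod_continuous s t : continuous s -> continuous t ->
  continuous (map_prod s t).
Proof.
move=> cs ct u; apply: (@cvg_pair _ _ _ _ (nbhs (s u.1)) (nbhs (t u.2))).
  by apply: (@continuous_comp _ _ _ fst s); [exact: cvg_fst|exact: cs].
by apply: (@continuous_comp _ _ _ snd t); [exact: cvg_snd|exact: ct].
Qed.

Lemma map_prod_open s t : open_map s -> open_map t -> open_map (map_prod s t).
Proof.
move=> os ot V oV; rewrite openE => _ [[x y] Vxy <-].
have [e e0 eV] := near_box (open_nbhs_nbhs (conj oV Vxy)).
pose I z := `]z - e, z + e[%classic : set R.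
have sI z : I z z by rewrite /I /= ?in_itv /=; lra.
have oI z : open (I z) by exact: itv_open.
exists (s @` I x, t @` I y).
  split; apply: open_nbhs_nbhs => /=.
    by split; [exact: os|exists x].
  by split; [exact: ot|exists y].
move=> [_ _] [/= [a + <-] [b + <-]]; rewrite /I /= !in_itv /= => xa yb.
by exists (a, b) => //; apply: eV.
Qed.

(** An increasing map of the whole line into the interval of radius [e] about [c], with 0 sent to
    [c]. It shrinks a chart while its domain remains the full plane. *)
Definition squash (c e t : R) := c + e * (t / (1 + `|t|)).

Lemma squash0 c e : squash c e 0 = c.
Proof. by rewrite /squash mul0r mulr0 addr0. Qed.

Lemma squash_continuous c e : continuous (squash c e).
Proof.
move=> t; apply: cvgD; first exact: cvg_cst.
apply: cvgM; first exact: cvg_cst.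
apply: cvgM; first exact: cvg_id.
apply: cvgV; first by rewrite gt_eqF // ltr_pwDl.
by apply: cvgD; [exact: cvg_cst|exact: norm_continuous].
Qed.

Lemma squash_incr c e x y : 0 < e -> x < y -> squash c e x < squash c e y.
Proof.
move=> e0 xy; rewrite /squash ltrD2l ltr_pM2l //.
have px : 0 < 1 + `|x| by rewrite ltr_pwDl.
have py : 0 < 1 + `|y| by rewrite ltr_pwDl.
rewrite ltr_pdivrMr // mulrAC ltr_pdivlMr //.
by case: (ger0P x) => ?; case: (ger0P y) => ?; nra.
Qed.

Lemma squash_bound c e t : 0 < e -> c - e < squash c e t < c + e.
Proof.
move=> e0; have pt : 0 < 1 + `|t| by rewrite ltr_pwDl.
have : -1 < t / (1 + `|t|) < 1.
  rewrite ltr_pdivrMr // ltr_pdivlMr //.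
  by case: (ger0P t) => ?; lra.
by rewrite /squash; move: (t / _) => r /andP[? ?]; nra.
Qed.

End RealMaps.

(** * Leaves of an oriented foliation *)

Section OrientedLines.
Variables (R : realType) (P : topologicalType).
Variables (F : set (set P)) (prec : P -> P -> Prop).
Hypothesis foliationF : line_foliation R F.
Hypothesis orientF : orientation R F prec.

Lemma leaf_prec L p : F L -> L p -> leaf prec p = L.
Proof.
move=> FL Lp; case: foliationF => -[_ tF _] _ _; case: orientF => o1 o2 _.
apply/seteqP; split=> q.
  have same q' r : prec q' r -> (L q' <-> L r).
    move=> /o1[L' FL' [L'q L'r]]; split=> Lx.
      by rewrite (tF L L' FL FL') //; [exists q'].
    by rewrite (tF L L' FL FL') //; [exists r].
  by move=> [->|[/same <-|/same ->]].
have [g [_ rg gP]] := o2 _ FL; rewrite -rg => -[t _ <-].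
move: Lp; rewrite -rg => -[s _ <-].
by have [st|ts|->] := ltgtP s t; [right; left; apply/gP|right; right; apply/gP|left].
Qed.

Lemma exists_leaf p : exists2 L, F L & L p.
Proof.
case: foliationF => -[cF _ _] _ _; have : [set: P] p by [].
by rewrite -cF => -[L FL Lp]; exists L.
Qed.

Lemma leaf_embedding p : exists gamma : R -> P, [/\ proper_embedding gamma,
  range gamma = leaf prec p & forall s t, prec (gamma s) (gamma t) <-> s < t].
Proof.
have [L FL Lp] := exists_leaf p; rewrite (leaf_prec FL Lp).
by case: orientF => _ + _; apply.
Qed.

Lemma line_order_prec : line_order R prec.
Proof. by move=> p; have [g [[cg _ _ _] rg gP]] := leaf_embedding p; exists g. Qed.

(** A point of the closure has a compact neighbourhood [K]. By properness the part of the leaf in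
    [K] is compact, hence closed, and the point already belongs to it. *)
Lemma closed_leaf p : homeomorphic P (R * R)%type -> closed (leaf prec p).
Proof.
move=> hP; have hausP := hausdorff_homeomorphic hP.
have [h [k [ch ck hK kH]]] := hP.
have [g [[cg _ _ pg] rg _]] := leaf_embedding p; rewrite -rg => z clz.
set u := h z.
pose K := k @` (`[u.1 - 1, u.1 + 1] `*` `[u.2 - 1, u.2 + 1]).
have cK : compact K.
  apply: continuous_compact; first exact: continuous_subspaceT.
  by apply: compact_setX; exact: segment_compact.
have Kz : nbhs z K.
  have : nbhs u (box (u.1 - 1) (u.1 + 1) (u.2 - 1) (u.2 + 1)).
    by apply: open_nbhs_nbhs; split; [exact: open_box|split; lra].
  move=> /(near_comp (@ch z)); apply: filterS => w [/andP[? ?] /andP[? ?]].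
  by exists (h w); [split; rewrite /= in_itv /= !ltW|rewrite hK].
have cl : closed (g @` (g @^-1` K)).
  apply: compact_closed => //; apply: continuous_compact; last exact: pg.
  exact: continuous_subspaceT.
have [t _ <-] : (g @` (g @^-1` K)) z; last by exists t.
apply: cl => V Vz; have [w [[t _ tw] [Vw Kw]]] := clz _ (filterI Vz Kz).
by exists w; split=> //; exists t => //=; rewrite tw.
Qed.

Lemma leaf_embedded_near p (g : R -> P) t (V : set R) :
  proper_embedding g -> range g = leaf prec p -> g t = p -> open V -> V t ->
  exists W, [/\ open W, W p & W `&` leaf prec p = g @` V].
Proof.
move=> [_ _ emb _] rg gt oV Vt; have [W oW WE] := emb V oV.
exists W; rewrite WE rg; split=> //.
have : (W `&` range g) p by rewrite -WE; exists t.
by case.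
Qed.

End OrientedLines.

(** * The direction of leaves in a chart *)

Section Sign.
Variables (R : realType) (P : topologicalType).
Variables (F : set (set P)) (prec : P -> P -> Prop).
Hypothesis foliationF : line_foliation R F.
Hypothesis orientF : orientation R F prec.
Variable psi : R * R -> P.
Hypotheses (cpsi : continuous psi) (ipsi : injective psi).
Hypothesis psi_leaf : forall x x' y, leaf prec (psi (x, y)) (psi (x', y)).

Let lineF := line_order_prec foliationF orientF.

Let ubox (u : R * R) e := box (u.1 - e) (u.1 + e) (u.2 - e) (u.2 + e).

Let pos u := exists2 e, 0 < e & forall x x' y, ubox u e (x, y) -> ubox u e (x', y) ->
  x < x' -> prec (psi (x, y)) (psi (x', y)).

Let neg u := exists2 e, 0 < e & forall x x' y, ubox u e (x, y) -> ubox u e (x', y) ->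
  x < x' -> prec (psi (x', y)) (psi (x, y)).

(* The increments of the first coordinate of an oriented chart along horizontal
   arcs do not vanish, and such arcs form a connected set: an arc is given by
   its left end and by the ratio at which its right end cuts the box. *)
Let local_sign u : pos u \/ neg u.
Proof.
have [o1 o2 o3] := orientF.
have [V [chi [[oV cchi [_ chi_inj _] _] Vu strF chi_prec]]] := o3 (psi u).
have nV : nbhs u (psi @^-1` V) by apply: cpsi; exact: open_nbhs_nbhs.
have [e e0 eV] := near_box nV.
have chi_y x x' y : ubox u e (x, y) -> ubox u e (x', y) ->
    (chi (psi (x, y))).2 = (chi (psi (x', y))).2.
  move=> xy x'y; have [L FL Lxy] := exists_leaf foliationF (psi (x, y)).
  have LE := leaf_prec foliationF orientF FL Lxy.
  pose A := (fun z => psi (z, y)) @` `]u.1 - e, u.1 + e[.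
  have cA : connected A.
    apply: connected_continuous_connected.
      by apply/connected_intervalP; exact: interval_is_interval.
    apply: continuous_subspaceT => z.
    by apply: continuous_comp; [exact: pairl_continuous|exact: cpsi].
  have ALV : A `<=` L `&` V.
    move=> _ [z + <-]; rewrite /= in_itv /= => ze; split; first by rewrite -LE; exact: psi_leaf.
    by apply: eV; split=> //; case: xy.
  have Ax z : ubox u e (z, y) -> A (psi (z, y)).
    by move=> [ze _]; exists z => //=; rewrite in_itv.
  have := connected_component_max (Ax _ xy) ALV cA (Ax _ x'y).
  by rewrite (strF L) => [[_ /= ->]| |]; [|by []|exact: ALV (Ax _ xy)].
pose f v := (chi (psi v)).1.
have cf v : ubox u e v -> {for v, continuous f}.
  move=> ve; have Vv : V (psi v) by exact: eV.
  apply: (@continuous_comp _ _ _ (chi \o psi) fst); last exact: cvg_fst.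
  apply: continuous_comp; first exact: cpsi.
  by move: cchi; rewrite continuous_open_subspace //; apply; rewrite inE.
have f_inj x x' y : ubox u e (x, y) -> ubox u e (x', y) -> x <> x' -> f (x, y) != f (x', y).
  move=> xy x'y xx'; apply/eqP => fxx'; apply: xx'.
  have chiE : chi (psi (x, y)) = chi (psi (x', y)).
    by move: fxx' (chi_y _ _ _ xy x'y); rewrite /f; case: (chi _) => a b; case: (chi _) => c d /= -> ->.
  have E := chi_inj _ _ (mem_set (eV _ xy)) (mem_set (eV _ x'y)) chiE.
  by case: (ipsi E).
pose a := u.1 - e; pose b := u.1 + e; pose c := u.2 - e; pose d := u.2 + e.
pose h (w : R * R * R) : R * R := (w.1.1 + w.1.2 * (b - w.1.1), w.2).
pose G w := f (h w) - f (w.1.1, w.2).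
pose Om : set (R * R * R) := (`]a, b[ `*` `]0, 1[) `*` `]c, d[.
have cOm : connected Om.
  by apply: connectedX; [apply: connectedX|]; apply/connected_intervalP; exact: interval_is_interval.
have OmP w : Om w -> [/\ ubox u e (h w), ubox u e (w.1.1, w.2) & w.1.1 < (h w).1].
  case: w => -[x s] y [[/=]]; rewrite !in_itv /= => /andP[ax xb] /andP[s0 s1] cyd.
  have H : 0 < s * (b - x) by rewrite mulr_gt0 ?subr_gt0.
  have H' : s * (b - x) < b - x by rewrite gtr_pMl ?subr_gt0.
  rewrite /h /=; split; [split=> //=|split=> //=|by lra].
    by rewrite -/a -/b; lra.
  by rewrite -/a -/b; lra.
have ch : continuous h.
  move=> w; apply: (@cvg_pair _ _ _ _ (nbhs (h w).1) (nbhs (h w).2)); last exact: cvg_snd.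
  have c11 : (fun w : R * R * R => w.1.1) @ w --> w.1.1.
    by apply: (@continuous_comp _ _ _ fst fst); exact: cvg_fst.
  have c12 : (fun w : R * R * R => w.1.2) @ w --> w.1.2.
    by apply: (@continuous_comp _ _ _ fst snd); [exact: cvg_fst|exact: cvg_snd].
  by apply: cvgD => //; apply: cvgM => //; apply: cvgB => //; exact: cvg_cst.
have ck : continuous (fun w : R * R * R => (w.1.1, w.2)).
  move=> w; apply: (@cvg_pair _ _ _ _ (nbhs w.1.1) (nbhs w.2)); last exact: cvg_snd.
  by apply: (@continuous_comp _ _ _ fst fst); exact: cvg_fst.
have cG w : Om w -> {for w, continuous G}.
  move=> /OmP[hw kw _]; apply: cvgB.
    by apply: (@continuous_comp _ _ _ h f); [exact: ch|exact: cf].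
  by apply: (@continuous_comp _ _ _ (fun w : R * R * R => (w.1.1, w.2)) f); [exact: ck|exact: cf].
have G0 w : Om w -> G w != 0.
  move=> /OmP[hw kw lw]; rewrite subr_eq0; apply: f_inj => // hE.
  by move: lw; rewrite /h /= hE ltxx.
have Gsign w w' : Om w -> Om w' -> 0 < G w -> 0 < G w'.
  apply: (@connected_near _ Om [set w | 0 < G w] cOm) => v Ov.
  have := G0 v Ov; rewrite neq_lt => /orP[Gv|Gv].
    apply: filterS (near_comp (cG v Ov) (lt_nbhsl Gv)) => r Gr _ /=.
    by split=> H; have := lt_trans H; [move/(_ _ Gr)|move/(_ _ Gv)]; rewrite ltxx.
  by apply: filterS (near_comp (cG v Ov) (lt_nbhsr Gv)) => r Gr _ /=.
have OmE x x' y : ubox u e (x, y) -> ubox u e (x', y) -> x < x' ->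
    exists2 w, Om w & G w = f (x', y) - f (x, y).
  move=> [/= /andP[xa xb] yc] [/= /andP[x'a x'b] _] xx'.
  have bx : 0 < b - x by rewrite subr_gt0.
  exists ((x, (x' - x) / (b - x)), y).
    split; rewrite /= ?in_itv /=; last by [].
    split; rewrite /= ?in_itv /=; first by rewrite xa xb.
    by rewrite divr_gt0 ?subr_gt0 //= ltr_pdivrMr // mul1r ltrD2r.
  by rewrite /G /h /= divfK ?gt_eqF // subrKC.
have [[w0 Ow0 G0']|nG] := pselect (exists2 w, Om w & 0 < G w).
  left; exists e => // x x' y xy x'y xx'.
  have [w Ow Gw] := OmE _ _ _ xy x'y xx'.
  apply: chi_prec; [exact: eV|exact: eV|exact: chi_y|].
  by have := Gsign _ _ Ow0 Ow G0'; rewrite Gw subr_gt0.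
right; exists e => // x x' y xy x'y xx'.
have [w Ow Gw] := OmE _ _ _ xy x'y xx'.
apply: chi_prec; [exact: eV|exact: eV|exact: chi_y|].
have := G0 w Ow; rewrite neq_lt => /orP[|Gp]; first by rewrite Gw subr_lt0.
by case: nG; exists w.
Qed.

Let pos_neg u : pos u -> neg u -> False.
Proof.
move=> [e e0 pe] [e' e'0 ne'].
pose m := Num.min e e' / 2.
have [m0 me me'] : [/\ 0 < m, m < e & m < e'].
  have : 0 < Num.min e e' by rewrite lt_min e0.
  have : Num.min e e' <= e by rewrite ge_min lexx.
  have : Num.min e e' <= e' by rewrite ge_min lexx orbT.
  by rewrite /m; split; lra.
have H1 : prec (psi (u.1, u.2)) (psi (u.1 + m, u.2)).
  by apply: pe; rewrite /ubox /box /=; try split; lra.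
have H2 : prec (psi (u.1 + m, u.2)) (psi (u.1, u.2)).
  by apply: ne'; rewrite /ubox /box /=; try split; lra.
exact: (lto_asym lineF H1 H2).
Qed.

Let ubox_sub u v e : ubox u e v -> exists2 d, 0 < d & ubox v d `<=` ubox u e.
Proof.
move=> uv; have := open_nbhs_nbhs (conj (@open_box _ _ _ _ _) uv).
by move=> /near_box.
Qed.

Let near_pos u : pos u -> \forall v \near u, pos v.
Proof.
move=> [e e0 pe]; have uu : ubox u e u by rewrite /ubox /box /=; split; lra.
apply: filterS (open_nbhs_nbhs (conj (@open_box _ _ _ _ _) uu)) => v /ubox_sub[d d0 du].
by exists d => // x x' y /du xy /du x'y; exact: pe.
Qed.

Let near_neg u : neg u -> \forall v \near u, neg v.
Proof.
move=> [e e0 pe]; have uu : ubox u e u by rewrite /ubox /box /=; split; lra.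
apply: filterS (open_nbhs_nbhs (conj (@open_box _ _ _ _ _) uu)) => v /ubox_sub[d d0 du].
by exists d => // x x' y /du xy /du x'y; exact: pe.
Qed.

Let pos_all u v : pos u -> pos v.
Proof.
have cR2 : connected [set: R * R].
  by apply: (@connected_homeomorphic R); exists id, id; split=> //; move=> ?; exact: cvg_id.
apply: (@connected_near _ setT pos cR2) => // w _.
have [pw|nw] := local_sign w.
  by apply: filterS (near_pos pw) => r pr _.
apply: filterS (near_neg nw) => r nr _.
by split=> pr; [case: (pos_neg pr nr)|case: (pos_neg pr nw)].
Qed.

(** The charts of transversality and those of the orientation are unrelated, so the direction of the
    leaves in the former has to be determined. Locally it has one of two signs; both are open
    conditions and they exclude each other, so the sign is constant on the plane. Short steps are
    then chained by transitivity. *)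
Lemma monotone_lines : (forall x x' y, x < x' -> prec (psi (x, y)) (psi (x', y))) \/
  (forall x x' y, x < x' -> prec (psi (x', y)) (psi (x, y))).
Proof.
have globalize (lt : P -> P -> Prop) : (forall p q r, lt p q -> lt q r -> lt p r) ->
    (forall u, exists2 e, 0 < e & forall x x' y, ubox u e (x, y) -> ubox u e (x', y) ->
      x < x' -> lt (psi (x, y)) (psi (x', y))) ->
    forall x x' y, x < x' -> lt (psi (x, y)) (psi (x', y)).
  move=> lt_tr loc x x' y xx'.
  pose Q a b := forall s t, a < s -> s < t -> t < b -> lt (psi (s, y)) (psi (t, y)).
  suff /(_ (x - 1) (x' + 1)) : forall a b, Q a b by apply; lra.
  apply: itv_ind.
  - by move=> a b a' b' aa bb Q1 s t as_ st tb; apply: Q1; lra.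
  - move=> a b c d ac cb bd Q1 Q2 s t as_ st td.
    have [tb|bt] := ltP t b; first by apply: Q1.
    have [cs|sc] := ltP c s; first by apply: Q2.
    apply: (lt_tr _ (psi ((c + b) / 2, y))); [apply: Q1|apply: Q2]; lra.
  - move=> z; have [e e0 eP] := loc (z, y); exists e => // s t zs st tz.
    by apply: eP => //; rewrite /ubox /box /=; split; lra.
have [pos0|neg0] := local_sign 0; [left|right].
  by apply: globalize => [p q r|u]; [exact: (lto_trans lineF)|exact: pos_all pos0].
apply: (globalize (fun p q => prec q p)) => [p q r pq qr|u]; first exact: (lto_trans lineF qr pq).
have [pu|//] := local_sign u.
by case: (pos_neg (pos_all 0 pu) neg0).
Qed.

End Sign.

Section Charts.
Variables (R : realType) (P : topologicalType).

(** Outside [U] the map [phi] is arbitrary; the inverse is meaningful on its whole domain, which is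
    why product charts go from the plane to [P]. *)
Lemma chart_inverse (U : set P) (phi : P -> R * R) : chart U phi ->
  exists psi : R * R -> P, [/\ continuous psi, injective psi, open_map psi,
    range psi = U & cancel psi phi].
Proof.
move=> [oU cphi [_ phi_inj phi_surj] phi_open].
have surj u : exists p, U p /\ phi p = u.
  by have [p Up pu] := phi_surj u I; exists p.
have [psi psiP] := choice surj.
have psiK : cancel psi phi by move=> u; have [] := psiP u.
have phiK p : U p -> psi (phi p) = p.
  by move=> Up; apply: phi_inj; rewrite ?inE // ?psiK //; have [] := psiP (phi p).
exists psi; split=> //.
- apply/continuousP => V oV.
  have -> : psi @^-1` V = phi @` (V `&` U).
    apply/seteqP; split=> u /=; last by move=> [p [Vp Up] <-]; rewrite phiK.
    by move=> Vu; exists (psi u); [split=> //; have [] := psiP u|exact: psiK].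
  by apply: phi_open; [exact: openI|move=> ? []].
- exact: can_inj psiK.
- move=> W oW; rewrite openE => _ [u Wu <-]; rewrite /interior.
  have Uu : U (psi u) by have [] := psiP u.
  have cu : {for psi u, continuous phi}.
    by move: cphi; rewrite continuous_open_subspace //; apply; rewrite inE.
  have Wn : nbhs (phi (psi u)) W by rewrite psiK; exact: open_nbhs_nbhs.
  apply: filterS2 (open_nbhs_nbhs (conj oU Uu)) (near_comp cu Wn) => p Up Wp.
  by exists (phi p) => //; exact: phiK.
- apply/seteqP; split=> [_ [u _ <-]|p Up]; first by have [] := psiP u.
  by exists (phi p) => //; exact: phiK.
Qed.

Lemma straightens_connected F U (phi : P -> R * R) c L (S : set P) p q :
  straightens F U phi c -> F L -> connected S -> S `<=` L `&` U -> S p -> S q ->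
  c (phi p) = c (phi q).
Proof.
move=> strF FL cS SLU Sp Sq.
have := connected_component_max Sp SLU cS Sq.
by rewrite (strF L p FL (SLU p Sp)) => -[_ /= ->].
Qed.

Lemma straightens_leaf F U (phi : P -> R * R) c L p q : straightens F U phi c ->
  F L -> (L `&` U) p -> U q -> c (phi q) = c (phi p) -> L q.
Proof.
move=> strF FL LUp Uq cqp.
have : (U `&` [set y | c (phi y) = c (phi p)]) q by [].
by rewrite -(strF L p FL LUp) => /connected_component_sub[].
Qed.

Lemma involutive_sign (Q : R -> R -> Prop) :
    (forall x y, x < y -> Q x y) \/ (forall x y, x < y -> Q y x) ->
  exists s : R -> R, [/\ continuous s, open_map s, involutive s
    & forall x y, x < y -> Q (s x) (s y)].
Proof.
move=> [QP|QP]; [exists id|exists (fun x => - x)]; split=> //.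
- by move=> x; exact: cvg_id.
- by move=> V; rewrite image_id.
- exact: opp_continuous.
- exact: open_map_opp.
- exact: opprK.
- by move=> x y xy; apply: QP; rewrite ltrN2.
Qed.

Lemma product_chart_comp lt1 lt2 (psi : R * R -> P) s t : product_chart lt1 lt2 psi ->
    continuous s -> continuous t -> open_map s -> open_map t ->
    {homo s : x y / x < y} -> {homo t : x y / x < y} ->
  product_chart lt1 lt2 (psi \o map_prod s t).
Proof.
move=> [cpsi ipsi opsi psi1 psi2 st1 st2] cs ct os ot sm tm.
have s_inj := inc_inj (fun x y => le_mono sm x y).
have t_inj := inc_inj (fun x y => le_mono tm x y).
have sub : range (psi \o map_prod s t) `<=` range psi.
  by move=> _ [u _ <-]; exists (map_prod s t u).
split.
- by move=> u; apply: continuous_comp; [exact: map_prod_continuous|exact: cpsi].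
- by move=> [x y] [x' y'] /ipsi[/s_inj -> /t_inj ->].
- by move=> V oV; rewrite -image_comp; apply: opsi; exact: map_prod_open.
- by move=> x x' y xx'; apply: psi1; exact: sm.
- by move=> x y y' yy'; apply: psi2; exact: tm.
- move=> S q cS Sr Sl u v Su Sv; apply: t_inj.
  exact: (st1 S q cS (subset_trans Sr sub) Sl _ _ Su Sv).
- move=> S q cS Sr Sl u v Su Sv; apply: s_inj.
  exact: (st2 S q cS (subset_trans Sr sub) Sl _ _ Su Sv).
Qed.

End Charts.

(** * From the given bifoliated plane to its working form *)

Section FromPlane.
Variables (R : realType) (B : bifoliated_plane R).

Lemma exists_product_chart p : exists psi : R * R -> B,
  product_chart (@prec1 R B) (@prec2 R B) psi /\ range psi p.
Proof.
have [f1 f2] := (fol1P B, fol2P B); have [o1 o2] := (prec1P B, prec2P B).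
have [U [phi [chU Up str1 str2]]] := fol_transverse p.
have [psi [cpsi ipsi opsi rpsi psiK]] := chart_inverse chU.
have Upsi u : U (psi u) by rewrite -rpsi; exists u.
have horiz x x' y : leaf (@prec1 R B) (psi (x, y)) (psi (x', y)).
  have [L FL Lp] := exists_leaf f1 (psi (x, y)); rewrite (leaf_prec f1 o1 FL Lp).
  by apply: (straightens_leaf str1 FL (conj Lp (Upsi _))); rewrite ?psiK.
have vert x y y' : leaf (@prec2 R B) (psi (x, y)) (psi (x, y')).
  have [L FL Lp] := exists_leaf f2 (psi (x, y)); rewrite (leaf_prec f2 o2 FL Lp).
  by apply: (straightens_leaf str2 FL (conj Lp (Upsi _))); rewrite ?psiK.
have m1 := monotone_lines f1 o1 cpsi ipsi horiz.
have m2 : (forall y y' x, y < y' -> @prec2 R B (psi (x, y)) (psi (x, y'))) \/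
    (forall y y' x, y < y' -> @prec2 R B (psi (x, y')) (psi (x, y))).
  apply: (@monotone_lines _ _ _ _ f2 o2 (psi \o @swap R)) => [u|u v|y y' x].
  - by apply: continuous_comp; [exact: swap_continuous|exact: cpsi].
  - by move=> /ipsi; case: u v => [? ?] [? ?] [-> ->].
  - exact: vert.
(* A coordinate along which the leaves run backwards is reversed. *)
have [s [cs os ss sP]] : exists s : R -> R, [/\ continuous s, open_map s, involutive s
    & forall x x', x < x' -> forall y, @prec1 R B (psi (s x, y)) (psi (s x', y))].
  apply: (@involutive_sign R (fun a b => forall y, @prec1 R B (psi (a, y)) (psi (b, y)))).
  by case: m1 => m; [left|right] => x x' xx' y; exact: m.
have [t [ct ot tt tP]] : exists t : R -> R, [/\ continuous t, open_map t, involutive t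
    & forall y y', y < y' -> forall x, @prec2 R B (psi (x, t y)) (psi (x, t y'))].
  apply: (@involutive_sign R (fun a b => forall x, @prec2 R B (psi (x, a)) (psi (x, b)))).
  by case: m2 => m; [left|right] => x x' xx' y; exact: m.
have rE : range (psi \o map_prod s t) = U.
  rewrite -rpsi; apply/seteqP; split=> _ [u _ <-]; first by exists (map_prod s t u).
  exists (map_prod s t u) => //=; congr psi; case: u => a b.
  by rewrite /map_prod /= ss tt.
exists (psi \o map_prod s t); split; last by rewrite rE.
split.
- move=> u; apply: continuous_comp; last exact: cpsi.
  exact: map_prod_continuous.
- by move=> [x y] [x' y'] /ipsi[/(can_inj ss) -> /(can_inj tt) ->].
- by move=> V oV; rewrite -image_comp; apply: opsi; exact: map_prod_open.
- by move=> x x' y xx'; exact: sP.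
- by move=> x y y' yy'; exact: tP.
- rewrite rE => S q cS SU Sl u v Su Sv.
  have [L FL Lq] := exists_leaf f1 q; rewrite (leaf_prec f1 o1 FL Lq) in Sl.
  have SLU : S `<=` L `&` U by move=> r Sr; split; [exact: Sl|exact: SU].
  have := straightens_connected str1 FL cS SLU Su Sv.
  by rewrite /= !psiK => /(can_inj tt).
- rewrite rE => S q cS SU Sl u v Su Sv.
  have [L FL Lq] := exists_leaf f2 q; rewrite (leaf_prec f2 o2 FL Lq) in Sl.
  have SLU : S `<=` L `&` U by move=> r Sr; split; [exact: Sl|exact: SU].
  have := straightens_connected str2 FL cS SLU Su Sv.
  by rewrite /= !psiK => /(can_inj ss).
Qed.

(** A leaf may return to a chart, but it is embedded: near [psi u] it reduces to a short arc. The
    arc is connected and stays in the chart, so the coordinate [c] is constant on it. *)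
Lemma local_leaf F (prec : B -> B -> Prop) (psi : R * R -> B) (c : R * R -> R) u :
    line_foliation R F -> orientation R F prec ->
    open (range psi) ->
    (forall S p, connected S -> S `<=` range psi -> S `<=` leaf prec p ->
      forall u v, S (psi u) -> S (psi v) -> c u = c v) ->
  exists W, [/\ open W, W (psi u) & forall v, W (psi v) -> leaf prec (psi u) (psi v) -> c v = c u].
Proof.
move=> fF oF orpsi str; set p := psi u.
have [g [ge rg gP]] := leaf_embedding fF oF p.
have [t _ gt] : range g p by rewrite rg; exact: leaf_refl.
have [cg _ _ _] := ge.
have : nbhs t (g @^-1` range psi).
  by apply: cg; apply: open_nbhs_nbhs; split=> //; rewrite gt; exists u.
move=> /nbhs_ballP[/= e e0 eP].
pose V := `]t - e, t + e[%classic : set R.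
have Vt : V t by rewrite /V /= in_itv /=; lra.
have [W [oW Wp WE]] := leaf_embedded_near ge rg gt (itv_open _ _ : open V) Vt.
exists W; split=> // v Wv lv.
have gV : (g @` V) (psi v) by rewrite -WE.
have gu : (g @` V) (psi u) by exists t.
apply: (str (g @` V) p _ _ _ v u gV gu).
- apply: connected_continuous_connected; last exact: continuous_subspaceT.
  by apply/connected_intervalP; exact: interval_is_interval.
- move=> _ [w + <-]; rewrite /V /= in_itv /= => wt; apply: eP.
  by rewrite -ball_normE /= ltr_distlC.
- by rewrite -rg => _ [w _ <-]; exists w.
Qed.

Lemma bifoliated_of_plane : bifoliated R (@prec1 R B) (@prec2 R B).
Proof.
have [f1 f2] := (fol1P B, fol2P B); have [o1 o2] := (prec1P B, prec2P B).
have hB := plane_homeo B.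
split=> //.
- exact: (line_order_prec f1 o1).
- exact: (line_order_prec f2 o2).
- by move=> p; exact: (closed_leaf f1 o1).
- by move=> p; exact: (closed_leaf f2 o2).
move=> p O Op; have [psi [pc [u _ up]]] := exists_product_chart p.
have orpsi := open_range_chart pc.
have [W1 [oW1 W1p W1P]] := local_leaf u f1 o1 orpsi (pc_straight1 pc).
have [W2 [oW2 W2p W2P]] := local_leaf u f2 o2 orpsi (pc_straight2 pc).
have : nbhs u (psi @^-1` (O `&` (W1 `&` W2))).
  apply: (pc_continuous pc); rewrite up; apply: filterI => //.
  by apply: filterI; apply: open_nbhs_nbhs; split=> //; rewrite -up.
move=> /near_box[e e0 eP].
have incr c x y : x < y -> squash c e x < squash c e y by exact: squash_incr.
(* The chart is restricted to a small box about [u], inside [O] and inside the neighbourhoods where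
   the two leaves of [p] do not return, and recentred at 0. *)
exists (psi \o map_prod (squash u.1 e) (squash u.2 e)).
have inO v : (O `&` (W1 `&` W2)) (psi (map_prod (squash u.1 e) (squash u.2 e) v)).
  by apply: eP; split; exact: squash_bound.
have sq0 c x : squash c e x = c -> x = 0.
  rewrite -{2}(squash0 c e); have [/(incr c)|/(incr c)|//] := ltgtP x 0.
    by move=> /[swap] ->; rewrite ltxx.
  by move=> /[swap] ->; rewrite ltxx.
split.
- apply: product_chart_comp => //; try exact: squash_continuous; try exact: incr.
  + by apply: open_map_incr; [exact: squash_continuous|exact: incr].
  + by apply: open_map_incr; [exact: squash_continuous|exact: incr].
- by rewrite /= /map_prod /= !squash0 -up; case: (u).
- by move=> _ [v _ <-]; have [] := inO v.
- move=> v pv; have [_ [W1v _]] := inO v; apply: (sq0 u.2).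
  by apply: (W1P _ W1v); rewrite up.
- move=> v pv; have [_ [_ W2v]] := inO v; apply: (sq0 u.1).
  by apply: (W2P _ W2v); rewrite up.
Qed.

End FromPlane.

Theorem theorem1 (R : realType) (B : bifoliated_plane R) :
  left_orderable (aut_plus B).
Proof.
have bB := bifoliated_of_plane B.
apply: (@left_orderable_action _ B (fun g : aut_plus B => aut_fun g)
  (point_lt (@prec1 R B) (@prec2 R B))).
- by [].
- exact: aut_plus_eq.
- exact: (point_lt_irr bB).
- exact: (point_lt_trans bB).
- exact: (point_lt_total bB).
- move=> g p q; have [_ _ g1 g2] := aut_funP g.
  exact: (point_lt_equivariant bB (@aut_funK _ _ g) (@aut_invK _ _ g)
    (@aut_fun_continuous _ _ g) (@aut_inv_continuous _ _ g) g1 g2).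
Qed.
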